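(* Let $k$ be a field. Assume that $(R,\mathfrak{m}_R)$ is a noetherian local $k$-algebra and $(T,\mathfrak{m}_T)$ is a complete $k$-algebra. Let $\varphi\colon (T,\mathfrak{m}_T)\to (R,\mathfrak{m}_R)$ be a flat $k$-algebra homomorphism, and let $\overline{R}=R/\mathfrak{m}_T R$ be the fiber ring of $\varphi$. Then the following statements are equivalent: (i) The $\overline{R}$-module $k$ is liftable to $R$. (ii) $\varphi$ has a retraction. (iii) There is an ideal $\mathfrak{a}$ of $R$ such that, setting $\mathfrak{m}_S=\mathfrak{a}$ and $S=k\oplus \mathfrak{m}_S$, the $k$-algebra $R$ admits a semi-fiber product decomposition $R\cong T\ltimes_k S$.
   Context: All rings are commutative with unity. A ''$k$-algebra'' $(R,\mathfrak{m}_R)$ means a (not necessarily local or noetherian) $k$-algebra $R$ with a specified maximal ideal $\mathfrak{m}_R$ such that the composition $k\hookrightarrow R\twoheadrightarrow R/\mathfrak{m}_R$ is an isomorphism; thus $R=k\oplus\mathfrak{m}_R$ as $k$-vector spaces. It is complete if it is complete in the $\mathfrak{m}_R$-adic topology (then it is a complete local ring). A $k$-algebra homomorphism $f\colon(R,\mathfrak{m}_R)\to(S,\mathfrak{m}_S)$ is always assumed to satisfy $f(\mathfrak{m}_R)\subseteq\mathfrak{m}_S$. Here $\mathfrak{m}_TR$ denotes the ideal of $R$ generated by $\varphi(\mathfrak{m}_T)$. Liftability: let $I\subseteq\mathfrak{m}_R$ be an ideal of $R$ and $\overline{R}=R/I$. A complex $F$ of free $\overline{R}$-modules is liftable to $R$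 (along the natural surjection $R\to\overline{R}$) if there is a complex $L$ of free $R$-modules with $L\otimes_R\overline{R}\cong F$ as $\overline{R}$-complexes. An $\overline{R}$-module $M$ is liftable to $R$ if there is an $\overline{R}$-free resolution of $M$ that is liftable to $R$. Here $k$ is the $\overline R$-module $\overline R/\mathfrak m_{\overline R}$, with $\mathfrak m_{\overline R}=\mathfrak m_R/I$. Retraction: if $f\colon R\to S$ and $g\colon S\to R$ are $k$-algebra homomorphisms with $f$ injective, $g$ surjective and $g\circ f=\mathrm{id}_R$, then $g$ is called a retraction of $f$. Semi-fiber product: let $(T,\mathfrak{m}_T)$ and $(S,\mathfrak{m}_S)$ be $k$-algebras with a $T$-action $\ast$ on $\mathfrak{m}_S$ under which $\mathfrak{m}_S$ becomes a $(T,S)$-bimodule (so $\ell\ast y=\ell y$ for $\ell\in k$, and $t\ast(ys)=(t\ast y)s$ for $t\in T$, $y\in\mathfrak{m}_S$, $s\in S$). The semi-fiber product $T\ltimes_k S$ is the $k$-vector space $k\oplus\mathfrak{m}_T\oplus\mathfrak{m}_S=T\oplus\mathfrak{m}_S$ with multiplication $(t\oplus y)\cdot(t'\oplus y')=tt'\oplus(t\ast y'+t'\ast y+yy')$ for $t,t'\in T$, $y,y'\in\mathfrak{m}_S$; it is a $k$-algebra with specified maximal ideal $\mathfrak{m}_T\oplus\mathfrak{m}_S$, and $T$ and $S$ are naturally $k$-subalgebras of it. A $k$-algebra $(A,\mathfrak{m}_A)$ admits a semi-fiber product decomposition if there exist $k$-subalgebras $(T,\mathfrak{m}_T)$ and $(S,\mathfrak{m}_S)$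 of $A$ such that an isomorphism $A\cong T\ltimes_k S$ of $k$-algebras holds.
   Formalization: In (iii) the isomorphism T ⋉_k S ≅ R is required to restrict to φ on T and to the inclusion on m_S = a; with an arbitrary isomorphism (iii)⇒(ii) fails, e.g. for k[[t]] → k[[x]], t ↦ x², a = 0. *)

(* Defs.v *)
From HB Require Import structures.
From mathcomp Require Import all_boot all_order all_algebra.
From mathcomp Require Import generic_quotient ring_quotient.
From mathcomp Require Import boolp classical_sets.
From mathcomp Require Import freeg.

Set Implicit Arguments.
Unset Strict Implicit.
Unset Printing Implicit Defensive.

Import GRing.Theory.

Local Open Scope ring_scope.
Local Open Scope quotient_scope.

(* An ideal of a commutative ring R (possibly the unit ideal) is a submodule of
   R^o.  Membership given by a proposition is made boolean through [asbool]. *)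
Notation ideal R := (submodClosed R^o).

(* [submodClosed] is stated over semirings and does not provide closure under
   opposites, which quotients need. *)
Definition submod_pred (A : pzRingType) (M : lmodType A) (N : submodClosed M)
  : {pred M} := N.

HB.instance Definition _ (A : pzRingType) (M : lmodType A)
    (N : submodClosed M) :=
  GRing.isZmodClosed.Build M (submod_pred N)
    (GRing.submod_closedB (submodClosedP N)).

Section IdealOperations.
Variables (R : comPzRingType) (I : ideal R).
Implicit Types x y : R.

Lemma ideal0 : (0 : R) \in I. Proof. exact: (rpred0 I). Qed.
Lemma idealD x y : x \in I -> y \in I -> x + y \in I.
Proof. exact: (rpredD (S := I)). Qed.
Lemma idealMl r x : x \in I -> r * x \in I.
Proof. exact: (@rpredZ R R^o I r x). Qed.

End IdealOperations.

Section Span.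
Variables (A : pzRingType) (M : lmodType A).

Definition span (S : set M) : {pred M} :=
  fun x => `[< exists2 s : seq (A * M),
    (forall p, p \in s -> S p.2) & x = \sum_(p <- s) p.1 *: p.2 >].

Lemma spanP (S : set M) x :
  reflect (exists2 s : seq (A * M),
    (forall p, p \in s -> S p.2) & x = \sum_(p <- s) p.1 *: p.2)
    (x \in span S).
Proof. exact: asboolP. Qed.

Lemma span_submod (S : set M) : submod_closed (span S).
Proof.
split=> [|a x y].
  by apply/spanP; exists [::]; rewrite ?big_nil.
move=> /spanP[s sS ->] /spanP[s' s'S ->]; apply/spanP.
exists ([seq (a * p.1, p.2) | p <- s] ++ s').
  move=> p; rewrite mem_cat => /orP[/mapP[q qs ->] | ps'] /=; first exact: sS.
  exact: s'S.
rewrite big_cat big_map /= scaler_sumr; congr (_ + _).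
by apply: eq_bigr => p _; rewrite scalerA.
Qed.

HB.instance Definition _ (S : set M) :=
  GRing.isSubmodClosed.Build A M (span S) (span_submod S).

Lemma mem_span (S : set M) x : S x -> x \in span S.
Proof.
move=> Sx; apply/spanP; exists [:: (1, x)]; last by rewrite big_seq1 scale1r.
by move=> p; rewrite inE => /eqP->.
Qed.

Lemma span_min (S : set M) (N : submodClosed M) :
  (forall x, S x -> x \in N) -> {subset span S <= N}.
Proof.
move=> SN x /spanP[s sS ->]; rewrite big_seq; apply: rpred_sum => p ps.
by apply: rpredZ; apply: SN; apply: sS.
Qed.

End Span.

Section Submodule.
Variables (A : pzRingType) (M : lmodType A) (N : submodClosed M).

Definition submodule : Type := {x : M | x \in N}.
HB.instance Definition _ := SubType.on submodule.
HB.instance Definition _ := Choice.on submodule.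
HB.instance Definition _ := [SubChoice_isSubLmodule of submodule by <:].

End Submodule.

Section QuotientModule.
Variables (A : pzRingType) (M : lmodType A) (N : submodClosed M).

Definition quotmod : Type := Quotient.quot (submod_pred N).
HB.instance Definition _ := GRing.Zmodule.on quotmod.
HB.instance Definition _ := EqQuotient.on quotmod.

Definition quotmod_pi (x : M) : quotmod := \pi_quotmod x.

Lemma quotmod_piE x y : (quotmod_pi x == quotmod_pi y) = (x - y \in N).
Proof. exact/esym/(Quotient.idealrBE (submod_pred N)). Qed.

Lemma quotmod_pi_surj q : exists x, quotmod_pi x = q.
Proof. by exists (repr q); apply: reprK. Qed.

Lemma quotmod_pi_zmod : zmod_morphism quotmod_pi.
Proof. exact: pi_is_zmod_morphism. Qed.
HB.instance Definition _ :=
  GRing.isZmodMorphism.Build M quotmod quotmod_pi quotmod_pi_zmod.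

Definition quotmod_scale (a : A) (q : quotmod) := quotmod_pi (a *: repr q).

Lemma quotmod_pi_scale a x : quotmod_scale a (quotmod_pi x) = quotmod_pi (a *: x).
Proof.
apply/eqP; rewrite quotmod_piE -scalerBr rpredZ // -quotmod_piE.
by apply/eqP/reprK.
Qed.

Fact quotmod_scaleA a b q :
  quotmod_scale a (quotmod_scale b q) = quotmod_scale (a * b) q.
Proof.
have [x <-] := quotmod_pi_surj q.
by rewrite !quotmod_pi_scale scalerA.
Qed.

Fact quotmod_scale1 : left_id 1 quotmod_scale.
Proof.
by move=> q; have [x <-] := quotmod_pi_surj q; rewrite quotmod_pi_scale scale1r.
Qed.

Fact quotmod_scaleDr : right_distributive quotmod_scale +%R.
Proof.
move=> a q r; have [x <-] := quotmod_pi_surj q.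
have [y <-] := quotmod_pi_surj r.
by rewrite -raddfD !quotmod_pi_scale scalerDr raddfD.
Qed.

Fact quotmod_scaleDl q : {morph quotmod_scale^~ q : a b / a + b}.
Proof.
move=> a b; have [x <-] := quotmod_pi_surj q.
by rewrite !quotmod_pi_scale scalerDl raddfD.
Qed.

HB.instance Definition _ := GRing.Zmodule_isLmodule.Build A quotmod
  quotmod_scaleA quotmod_scale1 quotmod_scaleDr quotmod_scaleDl.

Lemma quotmod_pi_scalable : scalable quotmod_pi.
Proof. by move=> a x; rewrite -quotmod_pi_scale. Qed.
HB.instance Definition _ :=
  GRing.isScalable.Build A M quotmod *:%R quotmod_pi quotmod_pi_scalable.

Lemma quotmod_ind (P : quotmod -> Prop) :
  (forall x, P (quotmod_pi x)) -> forall q, P q.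
Proof. by move=> HP q; have [x <-] := quotmod_pi_surj q. Qed.

End QuotientModule.

(* The library's quotient rings are restricted to proper ideals; R / I below
   is allowed to be the zero ring. *)
Section QuotientRing.
Variables (R : comPzRingType) (I : ideal R).

Definition quotring : Type := quotmod I.
HB.instance Definition _ := GRing.Zmodule.on quotring.

Definition quotring_pi (x : R) : quotring := quotmod_pi I x.

Lemma quotring_piE x y : (quotring_pi x == quotring_pi y) = (x - y \in I).
Proof. exact: quotmod_piE. Qed.

Lemma quotring_pi_surj q : exists x, quotring_pi x = q.
Proof. by have [x <-] := quotmod_pi_surj (q : quotmod I); exists x. Qed.

Lemma quotring_pi_zmod : zmod_morphism quotring_pi.
Proof. by move=> x y; apply: (@quotmod_pi_zmod R R^o I x y). Qed.
HB.instance Definition _ :=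
  GRing.isZmodMorphism.Build R quotring quotring_pi quotring_pi_zmod.

Definition quotring_mul (p q : quotring) : quotring :=
  quotring_pi ((repr (p : quotmod I) : R) * (repr (q : quotmod I) : R)).

Lemma quotring_pi_mul x y :
  quotring_mul (quotring_pi x) (quotring_pi y) = quotring_pi (x * y).
Proof.
have reprE z : (repr (quotring_pi z : quotmod I) : R) - z \in I.
  by rewrite -quotring_piE; apply/eqP/(reprK (quotring_pi z : quotmod I)).
apply/eqP; rewrite quotring_piE.
set x' := (repr (quotring_pi x : quotmod I) : R).
set y' := (repr (quotring_pi y : quotmod I) : R).
have -> : x' * y' - x * y = x' *: ((y' : R^o) - y) + y *: ((x' : R^o) - x).
  rewrite /GRing.scale /= !mulrBr [y * x']mulrC [y * x]mulrC.
  by rewrite addrA subrK.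
by apply: rpredD; apply: rpredZ; apply: reprE.
Qed.

Fact quotring_mulA : associative quotring_mul.
Proof.
move=> p q r; have [x <-] := quotring_pi_surj p.
have [y <-] := quotring_pi_surj q; have [z <-] := quotring_pi_surj r.
by rewrite !quotring_pi_mul mulrA.
Qed.

Fact quotring_mulC : commutative quotring_mul.
Proof.
move=> p q; have [x <-] := quotring_pi_surj p.
by have [y <-] := quotring_pi_surj q; rewrite !quotring_pi_mul mulrC.
Qed.

Fact quotring_mul1 : left_id (quotring_pi 1) quotring_mul.
Proof.
by move=> p; have [x <-] := quotring_pi_surj p; rewrite quotring_pi_mul mul1r.
Qed.

Fact quotring_mulDl : left_distributive quotring_mul +%R.
Proof.
move=> p q r; have [x <-] := quotring_pi_surj p.
have [y <-] := quotring_pi_surj q; have [z <-] := quotring_pi_surj r.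
by rewrite -raddfD !quotring_pi_mul mulrDl raddfD.
Qed.

HB.instance Definition _ := GRing.Zmodule_isComPzRing.Build quotring
  quotring_mulA quotring_mulC quotring_mul1 quotring_mulDl.

Lemma quotring_pi_monoid : monoid_morphism quotring_pi.
Proof. by split=> // x y; rewrite -quotring_pi_mul. Qed.
HB.instance Definition _ :=
  GRing.isMonoidMorphism.Build R quotring quotring_pi quotring_pi_monoid.

(* J / I, as an ideal of R / I. *)
Definition quot_ideal (J : ideal R) : {pred quotring^o} :=
  fun q => `[< exists2 x, x \in J & q = quotring_pi x >].

Lemma quot_ideal_submod (J : ideal R) :
  submod_closed (quot_ideal J).
Proof.
split=> [|a p q].
  by apply/asboolP; exists 0; rewrite ?rpred0 ?raddf0.
move=> /asboolP[x Jx ->] /asboolP[y Jy ->]; apply/asboolP.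
have [b <-] := quotring_pi_surj a.
exists (b *: (x : R^o) + y); first by rewrite rpredD // rpredZ.
by rewrite rmorphD rmorphM.
Qed.

HB.instance Definition _ (J : ideal R) :=
  GRing.isSubmodClosed.Build quotring quotring^o (quot_ideal J)
    (quot_ideal_submod J).

End QuotientRing.
Arguments quot_ideal {R} I J q.

Definition restr (A B : pzRingType) (f : {rmorphism A -> B}) (M : lmodType B)
  : Type := M.

Section RestrictionOfScalars.
Variables (A B : pzRingType) (f : {rmorphism A -> B}) (M : lmodType B).

HB.instance Definition _ := GRing.Zmodule.on (restr f M).

Definition restr_scale (a : A) (x : restr f M) : restr f M := f a *: (x : M).

Fact restr_scaleA a b x : restr_scale a (restr_scale b x) = restr_scale (a * b) x.
Proof. by rewrite /restr_scale scalerA rmorphM. Qed.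
Fact restr_scale1 : left_id 1 restr_scale.
Proof. by move=> x; rewrite /restr_scale rmorph1 scale1r. Qed.
Fact restr_scaleDr : right_distributive restr_scale +%R.
Proof. by move=> a x y; apply: scalerDr. Qed.
Fact restr_scaleDl x : {morph restr_scale^~ x : a b / a + b}.
Proof. by move=> a b; rewrite /restr_scale rmorphD scalerDl. Qed.

HB.instance Definition _ := GRing.Zmodule_isLmodule.Build A (restr f M)
  restr_scaleA restr_scale1 restr_scaleDr restr_scaleDl.

End RestrictionOfScalars.

Section FreegLift.
Variables (A : nzRingType) (K : choiceType) (P : lmodType A) (f : K -> P).

Definition freeg_lift : {freeg K / A} -> P := fglift f.

Lemma freeg_lift_zmod : zmod_morphism freeg_lift.
Proof. exact: lift_is_additive. Qed.
HB.instance Definition _ :=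
  GRing.isZmodMorphism.Build {freeg K / A} P freeg_lift freeg_lift_zmod.

Lemma freeg_liftE c x : freeg_lift << c *g x >> = c *: f x.
Proof. exact: liftU. Qed.

Lemma freeg_lift_scalable : scalable freeg_lift.
Proof.
move=> c D; rewrite -[in RHS](freeg_sumE D).
have -> : c *: D = \sum_(x <- dom D) << c * coeff x D *g x >> by [].
rewrite !raddf_sum; apply: eq_bigr => x _ /=.
by rewrite !freeg_liftE scalerA.
Qed.
HB.instance Definition _ :=
  GRing.isScalable.Build A {freeg K / A} P *:%R freeg_lift freeg_lift_scalable.

End FreegLift.

Section Tensor.
Variables (A : comNzRingType) (M N : lmodType A).

Inductive tensor_relator : {freeg (M * N)%type / A} -> Prop :=
| TensorDl x x' y :
    tensor_relator (<< (x + x', y) >> - << (x, y) >> - << (x', y) >>)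
| TensorDr x y y' :
    tensor_relator (<< (x, y + y') >> - << (x, y) >> - << (x, y') >>)
| TensorZl a x y : tensor_relator (<< (a *: x, y) >> - a *: << (x, y) >>)
| TensorZr a x y : tensor_relator (<< (x, a *: y) >> - a *: << (x, y) >>).

(* M (x)_A N: the free module on M * N modulo the bilinearity relations. *)
Definition tensor : Type := quotmod (span tensor_relator).
HB.instance Definition _ := GRing.Lmodule.on tensor.

Definition tens (x : M) (y : N) : tensor := quotmod_pi _ << (x, y) >>.

Lemma tensDl x x' y : tens (x + x') y = tens x y + tens x' y.
Proof.
rewrite /tens -raddfD; apply/eqP; rewrite quotmod_piE opprD addrA.
exact/mem_span/TensorDl.
Qed.

Lemma tensDr x y y' : tens x (y + y') = tens x y + tens x y'.
Proof.
rewrite /tens -raddfD; apply/eqP; rewrite quotmod_piE opprD addrA.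
exact/mem_span/TensorDr.
Qed.

Lemma tensZl a x y : tens (a *: x) y = a *: tens x y.
Proof.
by rewrite /tens -linearZ; apply/eqP; rewrite quotmod_piE; apply/mem_span/TensorZl.
Qed.

Lemma tensZr a x y : tens x (a *: y) = a *: tens x y.
Proof.
by rewrite /tens -linearZ; apply/eqP; rewrite quotmod_piE; apply/mem_span/TensorZr.
Qed.

Lemma tensor_ind (P : tensor -> Prop) :
  (forall x y, P (tens x y)) -> P 0 -> (forall u v, P u -> P v -> P (u + v)) ->
  forall u, P u.
Proof.
move=> Pt P0 PD u; elim/quotmod_ind: u => D.
rewrite -[D]freeg_sumE raddf_sum; elim/big_ind: _ => //= -[x y] _.
have -> : << coeff (x, y) D *g (x, y) >> = coeff (x, y) D *: << (x, y) >>
    :> {freeg (M * N)%type / A}.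
  by apply/eqP/freeg_eqP => z; rewrite coeffZ !coeffU mul1r.
have -> : quotmod_pi (span tensor_relator) (coeff (x, y) D *: << (x, y) >>) =
    tens (coeff (x, y) D *: x) y.
  by rewrite tensZl linearZ.
exact: Pt.
Qed.

Section Lift.
Variables (P : lmodType A) (b : M -> N -> P).

Definition tensor_lift (u : tensor) : P :=
  freeg_lift (fun p : M * N => b p.1 p.2)
    (repr (u : quotmod (span tensor_relator))).

Hypotheses (bDl : forall x x' y, b (x + x') y = b x y + b x' y)
  (bDr : forall x y y', b x (y + y') = b x y + b x y')
  (bZl : forall a x y, b (a *: x) y = a *: b x y)
  (bZr : forall a x y, b x (a *: y) = a *: b x y).

Local Notation g := (freeg_lift (fun p : M * N => b p.1 p.2)).

Lemma tensor_lift_pi (D : {freeg (M * N)%type / A}) :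
  tensor_lift (quotmod_pi _ D) = freeg_lift (fun p : M * N => b p.1 p.2) D.
Proof.
rewrite /tensor_lift.
set E := repr _; have : E - D \in span tensor_relator.
  by rewrite -quotmod_piE; apply/eqP/(reprK (quotmod_pi _ D)).
case/spanP=> s sS EB; apply/eqP; rewrite -subr_eq0 -raddfB EB raddf_sum.
rewrite big_seq big1 // => p /sS; rewrite /= linearZ /= => rel_p.
suff -> : g p.2 = 0 by rewrite scaler0.
have gU x y : g << (x, y) >> = b x y by rewrite freeg_liftE scale1r.
case: rel_p => [x x' y|x y y'|a x y|a x y]; rewrite !linearB /= ?linearZ /= !gU.
- by rewrite bDl addrAC addrK subrr.
- by rewrite bDr addrAC addrK subrr.
- by rewrite bZl scalerN subrr.
- by rewrite bZr scalerN subrr.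
Qed.

Lemma tensor_liftE x y : tensor_lift (tens x y) = b x y.
Proof. by rewrite tensor_lift_pi freeg_liftE scale1r. Qed.

Lemma tensor_lift_linear : linear tensor_lift.
Proof.
move=> a u v; elim/quotmod_ind: u => D; elim/quotmod_ind: v => E.
by rewrite -linearP !tensor_lift_pi linearP.
Qed.

End Lift.

End Tensor.

Section TensorMap.
Variables (A : comNzRingType) (M M' N N' : lmodType A).
Variables (f : {linear M -> M'}) (g : {linear N -> N'}).

Definition tensor_map : tensor M N -> tensor M' N' :=
  tensor_lift (fun x y => tens (f x) (g y)).

Lemma tensor_mapE x y : tensor_map (tens x y) = tens (f x) (g y).
Proof.
apply: tensor_liftE => *; rewrite ?linearD ?linearZ /=.
- exact: tensDl.
- exact: tensDr.
- exact: tensZl.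
- exact: tensZr.
Qed.

Lemma tensor_map_linear : linear tensor_map.
Proof.
apply: tensor_lift_linear => *; rewrite ?linearD ?linearZ /=.
- exact: tensDl.
- exact: tensDr.
- exact: tensZl.
- exact: tensZr.
Qed.
HB.instance Definition _ := GRing.isLinear.Build A (tensor M N) (tensor M' N')
  *:%R tensor_map tensor_map_linear.

End TensorMap.

Definition flat_module (A : comNzRingType) (N : lmodType A) : Prop :=
  forall (M M' : lmodType A) (f : {linear M -> M'}),
    injective f -> injective (tensor_map f (@idfun N)).

Definition flat_morphism (A : comNzRingType) (B : pzRingType)
  (f : {rmorphism A -> B}) : Prop := flat_module (restr f B^o).

(* M (x)_A B with its B-module structure, for f : A -> B. *)
Definition base_change (A : comNzRingType) (B : comPzRingType)
  (f : {rmorphism A -> B}) (M : lmodType A) : Type := tensor M (restr f B^o).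

Section BaseChange.
Variables (A : comNzRingType) (B : comPzRingType) (f : {rmorphism A -> B}).

Definition restr_mul (b : B) (c : restr f B^o) : restr f B^o :=
  b * (c : B) : B.

Lemma restr_mul_linear b : linear (restr_mul b).
Proof.
by move=> a c d; rewrite /restr_mul /GRing.scale /= /restr_scale mulrDr mulrCA.
Qed.
HB.instance Definition _ b := GRing.isLinear.Build A (restr f B^o)
  (restr f B^o) *:%R (restr_mul b) (restr_mul_linear b).

Section Module.
Variable M : lmodType A.

HB.instance Definition _ := GRing.Zmodule.on (base_change f M).

Definition base_change_scale (b : B) (u : base_change f M) : base_change f M :=
  tensor_map (@idfun M) (restr_mul b) u.

Fact base_change_scaleA b c u :
  base_change_scale b (base_change_scale c u) = base_change_scale (b * c) u.
Proof.
rewrite /base_change_scale; elim/tensor_ind: u => [x d||u v IHu IHv].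
- by rewrite !tensor_mapE /= /restr_mul mulrA.
- by rewrite !raddf0.
- by rewrite !raddfD /= IHu IHv.
Qed.

Fact base_change_scale1 : left_id 1 base_change_scale.
Proof.
move=> u; rewrite /base_change_scale; elim/tensor_ind: u => [x d||u v IHu IHv].
- by rewrite tensor_mapE /= /restr_mul mul1r.
- by rewrite raddf0.
- by rewrite raddfD /= IHu IHv.
Qed.

Fact base_change_scaleDr : right_distributive base_change_scale +%R.
Proof. by move=> b u v; apply: raddfD. Qed.

Fact base_change_scaleDl u : {morph base_change_scale^~ u : b c / b + c}.
Proof.
move=> b c; rewrite /base_change_scale; elim/tensor_ind: u => [x d||u v IHu IHv].
- by rewrite !tensor_mapE -tensDr /= /restr_mul mulrDl.
- by rewrite !raddf0 addr0.
- by rewrite !raddfD /= IHu IHv addrACA.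
Qed.

HB.instance Definition _ := GRing.Zmodule_isLmodule.Build B (base_change f M)
  base_change_scaleA base_change_scale1 base_change_scaleDr
  base_change_scaleDl.

End Module.

Section Map.
Variables (M M' : lmodType A) (h : {linear M -> M'}).

Definition base_change_map : base_change f M -> base_change f M' :=
  tensor_map h (@idfun (restr f B^o)).

Lemma base_change_map_linear : linear base_change_map.
Proof.
move=> b u v; rewrite -[LHS]/(tensor_map h idfun (_ + _)) raddfD; congr (_ + _).
rewrite /GRing.scale /= /base_change_scale /base_change_map.
elim/tensor_ind: u => [x d||u v' IHu IHv].
- by rewrite !tensor_mapE.
- by rewrite !raddf0.
- by rewrite !raddfD /= IHu IHv.
Qed.
HB.instance Definition _ := GRing.isLinear.Build B (base_change f M)
  (base_change f M') *:%R base_change_map base_change_map_linear.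

End Map.

End BaseChange.
Arguments base_change_map {A B} f {M M'} h u.

Section Complexes.
Variable A : pzRingType.

Definition is_basis (M : lmodType A) (B : set M) : Prop :=
  (forall x : M, x \in span B) /\
  (forall (s : seq M) (c : M -> A), uniq s -> (forall b, b \in s -> B b) ->
    \sum_(b <- s) c b *: b = 0 -> forall b, b \in s -> c b = 0).

Definition free_module (M : lmodType A) : Prop := exists B : set M, is_basis B.

(* Complexes are indexed by all of Z, with d_n : C_{n+1} -> C_n; writing the
   source as 1 + n makes the degree compute on nonnegative n. *)
Record chain_complex := ChainComplex {
  cobj :> int -> lmodType A;
  cdiff : forall n : int, {linear cobj (1 + n) -> cobj n};
  cdiffK : forall (n : int) (x : cobj (1 + (1 + n))),
    cdiff n (cdiff (1 + n) x) = 0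
}.

Definition free_complex (C : chain_complex) : Prop :=
  forall n, free_module (C n).

Definition complex_iso (C D : chain_complex) : Prop :=
  exists f : forall n : int, {linear C n -> D n},
    (forall n, bijective (f n)) /\
    (forall (n : int) (x : C (1 + n)), f n (cdiff C n x) = cdiff D n (f (1 + n) x)).

Definition resolution (C : chain_complex) (M : lmodType A) : Prop :=
  [/\ forall n : int, (n < 0)%R -> forall x : C n, x = 0,
      forall n : int, (0 <= n)%R -> forall x : C (1 + n),
        cdiff C n x = 0 -> exists y, x = cdiff C (1 + n) y
    & exists eps : {linear C 0 -> M},
        (forall m, exists x, eps x = m) /\
        (forall x, eps x = 0 <-> exists y, x = cdiff C 0 y)].

Definition free_resolution (C : chain_complex) (M : lmodType A) : Prop :=
  free_complex C /\ resolution C M.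

End Complexes.

Section Liftability.
Variables (A : comNzRingType) (B : comPzRingType) (f : {rmorphism A -> B}).

Lemma base_change_cdiffK (L : chain_complex A) (n : int)
    (u : base_change f (L (1 + (1 + n)))) :
  base_change_map f (cdiff L n) (base_change_map f (cdiff L (1 + n)) u) = 0.
Proof.
rewrite /base_change_map; elim/tensor_ind: u => [x b||u v IHu IHv].
- by rewrite !tensor_mapE /= cdiffK -(scale0r (0 : L n)) tensZl scale0r.
- by rewrite !raddf0.
- by rewrite !raddfD /= IHu IHv addr0.
Qed.

Definition base_change_complex (L : chain_complex A) : chain_complex B :=
  @ChainComplex B (fun n => base_change f (L n))
    (fun n => base_change_map f (cdiff L n)) (@base_change_cdiffK L).

End Liftability.

(* Liftability to R of complexes of free (R / I)-modules and of
   (R / I)-modules, along the projection R -> R / I. *)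
Definition liftable_complex (R : comNzRingType) (I : ideal R)
    (F : chain_complex (quotring I)) : Prop :=
  exists L : chain_complex R,
    free_complex L /\ complex_iso (base_change_complex (quotring_pi I) L) F.

Definition liftable_module (R : comNzRingType) (I : ideal R)
    (M : lmodType (quotring I)) : Prop :=
  exists F : chain_complex (quotring I), free_resolution F M /\ liftable_complex F.

Section Ideals.
Variable R : comNzRingType.

Definition maximal_ideal (m : ideal R) : Prop :=
  1 \notin m /\ forall I : ideal R,
    {subset m <= I} -> 1 \notin I -> {subset I <= m}.

Definition noetherian : Prop :=
  forall I : ideal R, exists s : seq R^o, I =i span [set x | x \in s].

Definition local_ring (m : ideal R) : Prop :=
  maximal_ideal m /\ forall I : ideal R, maximal_ideal I -> I =i m.

Definition ideal_prod (I J : ideal R) : ideal R :=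
  span [set x : R^o | exists y z : R, [/\ y \in I, z \in J & x = y * z]].

Fixpoint ideal_exp (I : ideal R) (n : nat) : ideal R :=
  if n is n'.+1 then ideal_prod I (ideal_exp I n') else span [set: R^o].

Definition adic_cvg (m : ideal R) (u : nat -> R) (l : R) : Prop :=
  forall n, exists N, forall i, (N <= i)%N -> u i - l \in ideal_exp m n.

Definition adic_cauchy (m : ideal R) (u : nat -> R) : Prop :=
  forall n, exists N, forall i j, (N <= i)%N -> (N <= j)%N ->
    u i - u j \in ideal_exp m n.

(* Completeness includes separatedness. *)
Definition adic_complete (m : ideal R) : Prop :=
  (forall x, (forall n, x \in ideal_exp m n) -> x = 0) /\
  (forall u, adic_cauchy m u -> exists l, adic_cvg m u l).

End Ideals.

Definition ideal_extension (A B : comNzRingType) (f : {rmorphism A -> B})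
    (I : ideal A) : ideal B :=
  span [set y : B^o | exists2 x, x \in I & y = f x].

Section KAlgebras.
Variable k : fieldType.

(* (R, m) is a k-algebra with specified maximal ideal m: k -> R / m is an
   isomorphism. *)
Definition is_kalgebra (R : comAlgType k) (m : ideal R) : Prop :=
  maximal_ideal m /\ bijective (fun c : k => quotring_pi m (c%:A : R)).

Definition kalgebra_hom (R S : comAlgType k) (mR : ideal R) (mS : ideal S)
    (f : {lrmorphism R -> S}) : Prop :=
  forall x, x \in mR -> f x \in mS.

Definition is_retraction (R S : comAlgType k) (mR : ideal R) (mS : ideal S)
    (f : {lrmorphism R -> S}) (g : {lrmorphism S -> R}) : Prop :=
  [/\ kalgebra_hom mR mS f, kalgebra_hom mS mR g,
      injective f, (forall x, exists y, g y = x) & forall x, g (f x) = x].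

Definition has_retraction (R S : comAlgType k) (mR : ideal R) (mS : ideal S)
    (f : {lrmorphism R -> S}) : Prop :=
  exists g : {lrmorphism S -> R}, is_retraction mR mS f g.

(* The residue field k = R / m_R as a module over R / I, for I contained in m_R:
   (R / I) / (m_R / I). *)
Definition residue_module (R : comAlgType k) (m I : ideal R) :
    lmodType (quotring I) :=
  quotmod (quot_ideal I m).

Section SubAlgebra.
Variables (R : comAlgType k) (a : ideal R).

(* The k-subspace k + a of R, a k-subalgebra; the sum is direct as soon as a is
   proper. *)
Definition kplus_pred : {pred R} := fun x => `[< exists c : k, x - c%:A \in a >].

Lemma kplus_predP x : reflect (exists c : k, x - c%:A \in a) (x \in kplus_pred).
Proof. exact: asboolP. Qed.

Lemma kplus_subalg : subalg_closed kplus_pred.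
Proof.
split=> [|c x y|x y].
- by apply/kplus_predP; exists 1; rewrite scale1r subrr ideal0.
- move=> /kplus_predP[d dx] /kplus_predP[e ey]; apply/kplus_predP.
  exists (c * d + e).
  have -> : c *: x + y - (c * d + e)%:A = c%:A * (x - d%:A) + (y - e%:A).
    by rewrite scalerDl -scalerA mulr_algl scalerBr opprD addrACA.
  by rewrite idealD ?idealMl.
- move=> /kplus_predP[d dx] /kplus_predP[e ey]; apply/kplus_predP.
  exists (d * e).
  have -> : x * y - (d * e)%:A = x * (y - e%:A) + e%:A * (x - d%:A).
    rewrite !mulrBr [e%:A * x]mulrC addrA subrK; congr (_ - _).
    by rewrite mulr_algl scalerA mulrC.
  by rewrite idealD ?idealMl.
Qed.
HB.instance Definition _ :=
  GRing.isSubalgClosed.Build k R kplus_pred kplus_subalg.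

Definition kplus : Type := {x : R | x \in kplus_pred}.
HB.instance Definition _ := SubType.on kplus.
HB.instance Definition _ := Choice.on kplus.
HB.instance Definition _ := [SubChoice_isSubAlgebra of kplus by <:].
HB.instance Definition _ := [SubNzRing_isSubComNzRing of kplus by <:].

(* a, as an ideal of k + a. *)
Definition kplus_ideal : {pred kplus^o} := fun s => (val (s : kplus) : R) \in a.

Lemma kplus_ideal_submod : submod_closed kplus_ideal.
Proof.
split=> [|s x y ax ay].
  by change ((val (0 : kplus) : R) \in a); rewrite raddf0 ideal0.
change ((val ((s : kplus) * x + y : kplus) : R) \in a).
by rewrite rmorphD rmorphM idealD ?idealMl.
Qed.
HB.instance Definition _ :=
  GRing.isSubmodClosed.Build kplus kplus^o kplus_ideal kplus_ideal_submod.

End SubAlgebra.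
Arguments kplus_ideal {R} a s.

Section SemiFiberProduct.
Variables (T S : comAlgType k) (mS : ideal S).

(* A (T, S)-bimodule structure on m_S extending its k- and S-structures. *)
Record bimodule_action := BimoduleAction {
  act :> T -> submodule mS -> submodule mS;
  actDl : forall t t' y, act (t + t') y = act t y + act t' y;
  actDr : forall t y y', act t (y + y') = act t y + act t y';
  actM : forall t t' y, act (t * t') y = act t (act t' y);
  act_scalar : forall (c : k) y, act c%:A y = (c%:A : S) *: y;
  act_bimod : forall t (s : S) y, act t (s *: y) = s *: act t y
}.

Definition semi_fiber (star : bimodule_action) : Type := (T * submodule mS)%type.

Section Algebra.
Variable star : bimodule_action.
Local Notation E := (semi_fiber star).

HB.instance Definition _ := GRing.Zmodule.on E.

Definition semi_fiber_one : E := (1, 0).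
Definition semi_fiber_mul (u v : E) : E :=
  (u.1 * v.1, star u.1 v.2 + star v.1 u.2 + (val u.2 : S) *: v.2).
Definition semi_fiber_scale (c : k) (u : E) : E := (c *: u.1, (c%:A : S) *: u.2).

Lemma val_mulC (y z : submodule mS) : (val y : S) *: z = (val z : S) *: y.
Proof. by apply: val_inj; rewrite !linearZ; apply: mulrC. Qed.

Lemma act1 y : star 1 y = y.
Proof. by rewrite -[1]scale1r act_scalar !scale1r. Qed.

Lemma act0r t : star t 0 = 0.
Proof. by apply: (addrI (star t 0)); rewrite -actDr !addr0. Qed.

Lemma act_val t y z : (val (star t y) : S) *: z = star t ((val y : S) *: z).
Proof. by rewrite val_mulC -act_bimod val_mulC. Qed.

Fact semi_fiber_mulC : commutative semi_fiber_mul.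
Proof.
move=> [t y] [t' y']; rewrite /semi_fiber_mul /= mulrC val_mulC.
by rewrite [star t y' + _]addrC.
Qed.

Fact semi_fiber_mulA : associative semi_fiber_mul.
Proof.
move=> [t y] [t' y'] [t'' y'']; rewrite /semi_fiber_mul /= mulrA.
congr (_, _).
rewrite !actDr !scalerDr -!actM !scalerDl !act_val -!act_bimod scalerA.
rewrite [t'' * t]mulrC [t'' * t']mulrC.
rewrite -!addrA; congr (_ + (_ + _)); rewrite [LHS]addrCA; congr (_ + _).
by rewrite [RHS]addrCA; congr (_ + _); rewrite addrCA.
Qed.

Fact semi_fiber_mul1 : left_id semi_fiber_one semi_fiber_mul.
Proof.
by move=> [t y]; rewrite /semi_fiber_mul /= mul1r act1 act0r addr0 scale0r addr0.
Qed.

Fact semi_fiber_mulDl : left_distributive semi_fiber_mul +%R.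
Proof.
move=> [t y] [t' y'] [t'' y'']; apply: (congr2 pair) => /=.
  exact: mulrDl.
rewrite actDl actDr scalerDl -!addrA; congr (_ + _).
rewrite [LHS]addrCA; congr (_ + _).
by rewrite [RHS]addrCA; congr (_ + _); rewrite addrCA.
Qed.

Fact semi_fiber_1neq0 : semi_fiber_one != 0.
Proof. by apply/eqP=> -[] /eqP; rewrite oner_eq0. Qed.

HB.instance Definition _ := GRing.Zmodule_isComNzRing.Build E
  semi_fiber_mulA semi_fiber_mulC semi_fiber_mul1 semi_fiber_mulDl
  semi_fiber_1neq0.

Fact semi_fiber_scaleA c d u :
  semi_fiber_scale c (semi_fiber_scale d u) = semi_fiber_scale (c * d) u.
Proof.
by rewrite /semi_fiber_scale /= !scalerA mulr_algl scalerA.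
Qed.

Fact semi_fiber_scale1 : left_id 1 semi_fiber_scale.
Proof. by case=> t y; rewrite /semi_fiber_scale /= !scale1r. Qed.

Fact semi_fiber_scaleDr : right_distributive semi_fiber_scale +%R.
Proof. by move=> c [t y] [t' y']; apply: (congr2 pair); apply: scalerDr. Qed.

Fact semi_fiber_scaleDl u : {morph semi_fiber_scale^~ u : c d / c + d}.
Proof. by move=> c d; apply: (congr2 pair); rewrite ?scalerDl. Qed.

HB.instance Definition _ := GRing.Zmodule_isLmodule.Build k E
  semi_fiber_scaleA semi_fiber_scale1 semi_fiber_scaleDr semi_fiber_scaleDl.

Fact semi_fiber_scaleAl (c : k) (u v : E) : c *: (u * v) = c *: u * v.
Proof.
case: u v => [t y] [t' y']; apply: (congr2 pair) => /=; first exact: scalerAl.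
have -> : star (c *: t) y' = (c%:A : S) *: star t y'.
  by rewrite -(mulr_algl c t) actM act_scalar.
rewrite act_bimod !scalerDr; congr (_ + _).
by rewrite scalerA.
Qed.

HB.instance Definition _ := GRing.Lmodule_isLalgebra.Build k E
  semi_fiber_scaleAl.
HB.instance Definition _ := GRing.Lalgebra_isComAlgebra.Build k E.

Definition semi_fiber_inl (t : T) : E := (t, 0).
Definition semi_fiber_inr (y : submodule mS) : E := (0, y).

(* The specified maximal ideal m_T (+) m_S. *)
Definition semi_fiber_ideal (mT : ideal T) : {pred E^o} :=
  fun u => (u : E).1 \in mT.

Lemma semi_fiber_ideal_submod mT : submod_closed (semi_fiber_ideal mT).
Proof.
split=> [|u v w mv mw]; first exact: ideal0.
by change ((u : E).1 * (v : E).1 + (w : E).1 \in mT); rewrite idealD ?idealMl.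
Qed.
HB.instance Definition _ mT :=
  GRing.isSubmodClosed.Build E E^o (semi_fiber_ideal mT)
    (semi_fiber_ideal_submod mT).

End Algebra.
End SemiFiberProduct.
Arguments semi_fiber_inl {T S mS} star t.
Arguments semi_fiber_inr {T S mS} star y.
Arguments semi_fiber_ideal {T S mS} star mT u.

(* R = T |x_k S with S = k + a and m_S = a: an isomorphism of k-algebras from
   the semi-fiber product onto R that restricts to f on T (viewed in R through
   f) and to the inclusion on m_S. *)
Definition semi_fiber_decomposition (T R : comAlgType k) (mT : ideal T)
    (mR : ideal R) (f : {lrmorphism T -> R}) (a : ideal R) : Prop :=
  is_kalgebra (kplus_ideal a) /\
  exists (star : bimodule_action T (kplus_ideal a))
         (theta : {lrmorphism semi_fiber star -> R}),
    [/\ bijective theta,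
        kalgebra_hom (semi_fiber_ideal star mT) mR theta,
        forall t, theta (semi_fiber_inl star t) = f t
      & forall y : submodule (kplus_ideal a),
          theta (semi_fiber_inr star y) = val (val y : kplus a)].

End KAlgebras.
Arguments kplus_ideal {k R} a s.
Arguments semi_fiber_inl {k T S mS} star t.
Arguments semi_fiber_inr {k T S mS} star y.
Arguments semi_fiber_ideal {k T S mS} star mT u.

(* Main.v *)
From HB Require Import structures.
From mathcomp Require Import all_boot all_order all_algebra.
From mathcomp Require Import boolp classical_sets freeg.
Require Import Defs.

(** Flatness enters only through its equational form: a module is flat exactly
    when each of its linear relations comes from relations between scalars
    ([relations_trivial]).  In matrix form this passes from [R] to free
    [R]-modules, and from two terms of a short exact sequence to the kernel
    ([kernel_relations_trivial]), whose intersection with [J L] is then [J]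
    times the kernel ([kernel_ideal_mul]).

    A retraction [g] makes [T] an [R]-module.  Resolve it by free [R]-modules:
    over [T] the resolved module is [T] itself, so all syzygies are flat over
    [T], and reducing the resolution modulo [mT R] keeps it exact
    ([reduced_exact]).  The reduction resolves [T / mT = k]
    ([retraction_liftable]).

    Conversely let [L] lift a free resolution of [k], with first differential
    [d : L1 -> L0], and let [e] in [L0] lift [1] in [k].  Exactness of the
    reduction in degree one, fed through flatness, shows by induction on [n]
    that [y] lies in [ker d + mT^n L1] as soon as [d y] lies in [mT^n L0]
    ([kernel_adic]).  Hence modulo [d L1 + mT^n L0] every element of [L0] is
    [t e] ([generator_spans]) for a [t] that is unique modulo [mT^n]
    ([generator_free]): the quotient is free of rank one over [T / mT^n].
    Completeness of [T] glues these into a unique [g r] in [T] with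
    [r e = g r e] modulo all [d L1 + mT^n L0], and uniqueness makes [g] a
    homomorphism that retracts [phi] ([lifting_retraction]).

    A semi-fiber decomposition is the splitting [R = phi(T) + ker g]: the first
    projection of the product is a retraction, and [T] acts on [ker g] by
    multiplication through [phi] ([retraction_semi_fiber]). *)

Set Implicit Arguments.
Unset Strict Implicit.
Unset Printing Implicit Defensive.

Import GRing.Theory.
Local Open Scope ring_scope.

(** * Kernels and products of an ideal with a module *)

Section Kernel.
Variables (A : pzRingType) (M N : lmodType A) (h : {linear M -> N}).

Definition kernel : {pred M} := fun x => h x == 0.

Lemma kernelP x : reflect (h x = 0) (x \in kernel).
Proof. exact: eqP. Qed.

Lemma kernel_submod : submod_closed kernel.
Proof.
split=> [|a x y /kernelP hx /kernelP hy]; apply/kernelP; first exact: raddf0.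
by rewrite linearP hx hy scaler0 addr0.
Qed.
HB.instance Definition _ := GRing.isSubmodClosed.Build A M kernel kernel_submod.

End Kernel.

Section IdealMul.
Variables (A : comPzRingType) (J : ideal A).

Definition ideal_mul (M : lmodType A) : submodClosed M :=
  span [set x : M | exists (t : A) (y : M), t \in J /\ x = t *: y]%classic.

Lemma ideal_mulP (M : lmodType A) (x : M) :
  reflect (exists n (t : 'I_n -> A) (y : 'I_n -> M),
             (forall i, t i \in J) /\ x = \sum_i t i *: y i)
          (x \in ideal_mul M).
Proof.
apply: (iffP idP) => [/spanP[s sJ ->]|[n [t [y [tJ ->]]]]].
  have /choice[f fP] (i : 'I_(size s)) :
      exists p : A * M, p.1 \in J /\ (tnth (in_tuple s) i).2 = p.1 *: p.2.
    have [t [y [tJ E]]] := sJ _ (mem_tnth i (in_tuple s)).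
    by exists (t, y).
  exists (size s), (fun i => (f i).1), (fun i => (tnth (in_tuple s) i).1 *: (f i).2).
  split=> [i|]; first by have [] := fP i.
  rewrite (big_tnth _ _ s); apply: eq_bigr => i _.
  by rewrite (fP i).2 !scalerA mulrC.
by apply: rpred_sum => i _; apply: mem_span; exists (t i), (y i).
Qed.

Lemma mem_ideal_mul (M : lmodType A) t (y : M) : t \in J -> t *: y \in ideal_mul M.
Proof. by move=> tJ; apply: mem_span; exists t, y. Qed.

End IdealMul.

Lemma sub_ideal_mul (A : comPzRingType) (J J' : ideal A) (M : lmodType A) :
  {subset J <= J'} -> {subset ideal_mul J M <= ideal_mul J' M}.
Proof.
move=> sJ x /ideal_mulP[n [t [y [tJ ->]]]]; apply: rpred_sum => i _.
exact/mem_ideal_mul/sJ.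
Qed.

(** * Trivial relations: the equational form of flatness *)

Section TensorSums.
Variables (A : comNzRingType) (M N : lmodType A).

Lemma tens0l (y : N) : tens (0 : M) y = 0.
Proof. by rewrite -(scale0r (0 : M)) tensZl scale0r. Qed.

Lemma tens0r (x : M) : tens x (0 : N) = 0.
Proof. by rewrite -(scale0r (0 : N)) tensZr scale0r. Qed.

Lemma tens_suml I (r : seq I) (F : I -> M) (y : N) :
  tens (\sum_(i <- r) F i) y = \sum_(i <- r) tens (F i) y.
Proof. exact: (big_morph (fun x => tens x y) (fun x x' => tensDl x x' y) (tens0l y)). Qed.

Lemma tens_sumr I (r : seq I) (x : M) (F : I -> N) :
  tens x (\sum_(i <- r) F i) = \sum_(i <- r) tens x (F i).
Proof. exact: (big_morph (tens x) (tensDr x) (tens0r x)). Qed.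

End TensorSums.

Section Relations.
Variable A : comNzRingType.

Definition trivial_relation (M : lmodType A) m n (U : 'M[A]_(m, n))
    (z : 'I_n -> M) : Prop :=
  exists p (V : 'M[A]_(n, p)) (w : 'I_p -> M),
    U *m V = 0 /\ forall j, z j = \sum_l V j l *: w l.

(** Several relations are treated at once, as the rows of a matrix: the
    syzygy argument has to lift all the relations between coefficients
    together. *)
Definition relations_trivial (M : lmodType A) : Prop :=
  forall m n (U : 'M[A]_(m, n)) (z : 'I_n -> M),
    (forall i, \sum_j U i j *: z j = 0) -> trivial_relation U z.

Lemma trivial_relation0 (M : lmodType A) m n (U : 'M[A]_(m, n)) :
  trivial_relation U (fun _ => 0 : M).
Proof.
exists 0%N, 0, (fun _ => 0); split; first exact: mulmx0.
by move=> j; rewrite big_ord0.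
Qed.

Lemma trivial_relationD (M : lmodType A) m n (U : 'M[A]_(m, n)) (z z' : 'I_n -> M) :
  trivial_relation U z -> trivial_relation U z' ->
  trivial_relation U (fun j => z j + z' j).
Proof.
move=> [p [V [w [UV zE]]]] [p' [V' [w' [UV' zE']]]].
exists (p + p')%N, (row_mx V V'),
  (fun l => match split l with inl i => w i | inr i => w' i end).
split=> [|j]; first by rewrite mul_mx_row UV UV' row_mx0.
rewrite big_split_ord zE zE' /=; congr (_ + _); apply: eq_bigr => i _.
  by rewrite row_mxEl (unsplitK (inl i)).
by rewrite row_mxEr (unsplitK (inr i)).
Qed.

Lemma trivial_relation_map (M N : lmodType A) (h : {linear M -> N}) m n
    (U : 'M[A]_(m, n)) (z : 'I_n -> M) :
  trivial_relation U z -> trivial_relation U (fun j => h (z j)).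
Proof.
move=> [p [V [w [UV zE]]]]; exists p, V, (fun l => h (w l)); split=> // j.
by rewrite zE raddf_sum; apply: eq_bigr => l _; rewrite /= linearZ.
Qed.

Section Flat.
Variables (M : lmodType A) (m n : nat) (U : 'M[A]_(m, n)).

Let K : submodClosed 'cV[A]_n := kernel (mulmx U : {linear 'cV[A]_n -> 'cV[A]_m}).

Let Ubar (q : quotmod K) : 'cV[A]_m := U *m repr q.

Let UbarE v : Ubar (quotmod_pi K v) = U *m v.
Proof.
apply/eqP; rewrite -subr_eq0 -mulmxBr; apply/eqP/kernelP.
by rewrite -quotmod_piE; apply/eqP/(reprK (quotmod_pi K v)).
Qed.

Let Ubar_linear : linear Ubar.
Proof.
move=> a q q'; elim/quotmod_ind: q => v; elim/quotmod_ind: q' => v'.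
by rewrite -linearP !UbarE mulmxDr scalemxAr.
Qed.
HB.instance Definition _ :=
  GRing.isLinear.Build A (quotmod K) 'cV[A]_m *:%R Ubar Ubar_linear.

Let Ubar_inj : injective Ubar.
Proof.
move=> q q'; elim/quotmod_ind: q => v; elim/quotmod_ind: q' => v'.
move=> E; apply/eqP; rewrite quotmod_piE; apply/kernelP.
by rewrite /= mulmxBr -!UbarE E subrr.
Qed.

Let outer (v : 'cV[A]_n) (x : M) : {ffun 'I_n -> M} := [ffun j => v j 0 *: x].

Let KM : submodClosed {ffun 'I_n -> M} :=
  span [set f | exists v x, v \in K /\ f = outer v x]%classic.

Let bil (q : quotmod K) (x : M) : quotmod KM := quotmod_pi KM (outer (repr q) x).

Let bilE v x : bil (quotmod_pi K v) x = quotmod_pi KM (outer v x).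
Proof.
apply/eqP; rewrite quotmod_piE; apply: mem_span.
exists (repr (quotmod_pi K v) - v), x; split.
  by rewrite -quotmod_piE; apply/eqP/(reprK (quotmod_pi K v)).
by apply/ffunP => j; rewrite !ffunE !mxE scalerBl.
Qed.

Let bilDl q q' x : bil (q + q') x = bil q x + bil q' x.
Proof.
elim/quotmod_ind: q => v; elim/quotmod_ind: q' => v'.
rewrite -raddfD !bilE -raddfD; congr quotmod_pi.
by apply/ffunP => j; rewrite !ffunE !mxE scalerDl.
Qed.

Let bilDr q x x' : bil q (x + x') = bil q x + bil q x'.
Proof.
elim/quotmod_ind: q => v; rewrite !bilE -raddfD.
by congr quotmod_pi; apply/ffunP => j; rewrite !ffunE scalerDr.
Qed.

Let bilZl a q x : bil (a *: q) x = a *: bil q x.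
Proof.
elim/quotmod_ind: q => v; rewrite -linearZ !bilE -linearZ.
by congr quotmod_pi; apply/ffunP => j; rewrite !ffunE mxE scalerA.
Qed.

Let bilZr a q x : bil q (a *: x) = a *: bil q x.
Proof.
elim/quotmod_ind: q => v; rewrite !bilE -linearZ.
by congr quotmod_pi; apply/ffunP => j; rewrite !ffunE !scalerA mulrC.
Qed.

HB.instance Definition _ := GRing.isLinear.Build A (tensor (quotmod K) M)
  (quotmod KM) *:%R (tensor_lift bil)
  (tensor_lift_linear bilDl bilDr bilZl bilZr).

(** Flatness applies to the injection [A^n / ker U -> A^m] that [U] induces:
    since [U z = 0], the element [sum_j e_j (x) z_j] vanishes in
    [(A^n / ker U) (x) M].  Its image in [M^n / (ker U) M] is the class of [z],
    which is therefore a combination of columns of [ker U]. *)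
Lemma flat_trivial_relation (z : 'I_n -> M) :
  flat_module M -> (forall i, \sum_j U i j *: z j = 0) -> trivial_relation U z.
Proof.
move=> flatM Uz.
pose u : tensor (quotmod K) M := \sum_j tens (quotmod_pi K (delta_mx j 0)) (z j).
have u0 : u = 0.
  apply: (flatM _ _ Ubar Ubar_inj); rewrite raddf0 raddf_sum /=.
  under eq_bigr => j _.
    rewrite tensor_mapE /= UbarE -colE [col j U]matrix_sum_delta tens_suml.
    under eq_bigr => i _ do rewrite big_ord1 mxE tensZl -tensZr.
    over.
  rewrite exchange_big big1 // => i _.
  by rewrite -tens_sumr Uz tens0r.
have : quotmod_pi KM (finfun z) = 0.
  have <- : tensor_lift bil u = 0 by rewrite u0 raddf0.
  rewrite raddf_sum /= (eq_bigr _ (fun j _ => tensor_liftE bilDl bilDr bilZl bilZr _ _)).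
  rewrite (eq_bigr _ (fun j _ => bilE _ _)) -raddf_sum; congr quotmod_pi.
  apply/ffunP => i; rewrite sum_ffunE ffunE (bigD1 i) //= ffunE mxE !eqxx scale1r.
  by rewrite big1 ?addr0 // => j /negPf ji; rewrite ffunE mxE eq_sym ji scale0r.
move/eqP; rewrite -(raddf0 (quotmod_pi KM)) quotmod_piE subr0.
case/spanP=> s sKM E.
have /choice[f fP] (l : 'I_(size s)) : exists p : 'cV[A]_n * M,
    p.1 \in K /\ (tnth (in_tuple s) l).2 = outer p.1 p.2.
  by have [v [x [vK ->]]] := sKM _ (mem_tnth l (in_tuple s)); exists (v, x).
exists (size s), (\matrix_(j, l) ((tnth (in_tuple s) l).1 * (f l).1 j 0)),
  (fun l => (f l).2); split=> [|j].
  apply/matrixP => i l; have [/kernelP/colP/(_ i)] := fP l.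
  rewrite !mxE => Uf0 _; have := congr1 (GRing.mul (tnth (in_tuple s) l).1) Uf0.
  rewrite mulr0 mulr_sumr => aUf0; rewrite -[RHS]aUf0.
  by apply: eq_bigr => j _; rewrite !mxE mulrCA.
move/ffunP/(_ j): E; rewrite ffunE (big_tnth _ _ s) sum_ffunE => ->.
by apply: eq_bigr => l _; rewrite ffunE (fP l).2 ffunE mxE scalerA.
Qed.
End Flat.

Lemma flat_relations_trivial (M : lmodType A) : flat_module M -> relations_trivial M.
Proof. by move=> flatM m n U z; apply: flat_trivial_relation. Qed.
End Relations.

Lemma trivial_relation_sum (A : comNzRingType) (M : lmodType A) m n
    (U : 'M[A]_(m, n)) (I : eqType) (r : seq I) (F : I -> 'I_n -> M) :
  (forall i, i \in r -> trivial_relation U (F i)) ->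
  trivial_relation U (fun j => \sum_(i <- r) F i j).
Proof.
elim: r => [|i r IHr] Fr.
  under eq_fun => j do rewrite big_nil.
  exact: trivial_relation0.
under eq_fun => j do rewrite big_cons.
apply: trivial_relationD; first by apply: Fr; rewrite mem_head.
by apply: IHr => i' ri'; apply: Fr; rewrite inE ri' orbT.
Qed.

Section Restriction.
Variables (A B : comNzRingType) (phi : {rmorphism A -> B}).
Variables (M N : lmodType B).

Definition restr_map (h : {linear M -> N}) : restr phi M -> restr phi N := h.

Lemma restr_map_linear h : linear (restr_map h).
Proof. by move=> a x y; rewrite /restr_map [LHS](linearP h). Qed.
HB.instance Definition _ h := GRing.isLinear.Build A (restr phi M) (restr phi N)
  *:%R (restr_map h) (restr_map_linear h).

Definition restr_scaler (b : M) (x : restr phi B^o) : restr phi M := (x : B) *: b.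

Lemma restr_scaler_linear b : linear (restr_scaler b).
Proof.
move=> a x y; rewrite /restr_scaler [LHS]scalerDl; congr (_ + _).
by rewrite -[LHS]scalerA.
Qed.
HB.instance Definition _ b := GRing.isLinear.Build A (restr phi B^o) (restr phi M)
  *:%R (restr_scaler b) (restr_scaler_linear b).

(** A relation between elements of a free module is a relation between their
    coordinates on each basis element. *)
Lemma free_relations_trivial :
  relations_trivial (restr phi B^o) -> free_module M ->
  relations_trivial (restr phi M).
Proof.
move=> trivB [S [spanS freeS]] m n U z Uz.
have /choice[s sP] j : exists s : seq (B * M),
    (forall p, p \in s -> S p.2) /\ (z j : M) = \sum_(p <- s) p.1 *: p.2.
  by have /spanP[s sS E] := spanS (z j); exists s.
pose u := undup (flatten [seq [seq p.2 | p <- s j] | j <- enum 'I_n]).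
pose c j b : B := \sum_(p <- s j | p.2 == b) p.1.
have mem_u j p : p \in s j -> p.2 \in u.
  move=> sjp; rewrite mem_undup; apply/flatten_mapP; exists j; first exact: mem_enum.
  exact: map_f.
have uS b : b \in u -> S b.
  rewrite mem_undup => /flatten_mapP[j _ /mapP[p sjp ->]].
  exact: (sP j).1 sjp.
have zE j : (z j : M) = \sum_(b <- u) c j b *: b.
  rewrite (sP j).2; transitivity (\sum_(p <- s j) \sum_(b <- u | p.2 == b) p.1 *: b).
    rewrite !big_seq; apply: eq_bigr => p /mem_u up.
    rewrite big_mkcond (bigD1_seq p.2) ?undup_uniq //= eqxx big1 ?addr0 //.
    by move=> b /negPf; rewrite eq_sym => ->.
  rewrite (exchange_big_dep predT) //=; apply: eq_bigr => b _.
  by rewrite scaler_suml.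
have Uc i b : b \in u -> \sum_j phi (U i j) * c j b = 0.
  apply: (freeS u (fun b => \sum_j phi (U i j) * c j b)) => //; first exact: undup_uniq.
  rewrite -[RHS](Uz i); under eq_bigr => b' _ do rewrite scaler_suml.
  rewrite exchange_big; apply: eq_bigr => j _.
  rewrite /GRing.scale /= /restr_scale zE scaler_sumr; apply: eq_bigr => b' _.
  by rewrite scalerA.
have -> : z = (fun j => \sum_(b <- u) (c j b *: b : restr phi M)).
  by apply/funext => j; apply: zE.
apply: trivial_relation_sum => b ub.
apply: (trivial_relation_map (restr_scaler b) (z := fun j => c j b : restr phi B^o)).
by apply: trivB => i; apply: Uc.
Qed.

End Restriction.
Arguments restr_map {A B} phi {M N} h x.

Section Syzygy.
Variables (A : comNzRingType) (L N : lmodType A) (h : {linear L -> N}).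
Hypotheses (trivL : relations_trivial L) (trivN : relations_trivial N).
Hypothesis surj_h : forall y, exists x, h x = y.

(** This is the vanishing of [Tor_1 (N, A / J)].  If [x = sum_i t_i y_i] then
    [sum_i t_i h(y_i) = 0] is a trivial relation in [N], and lifting the
    elements that trivialise it to [L] corrects each [y_i] by an element that
    brings it into the kernel without changing the sum. *)
Lemma kernel_ideal_mul (J : ideal A) x :
  h x = 0 -> x \in ideal_mul J L ->
  exists n (t : 'I_n -> A) (y : 'I_n -> L),
    (forall i, t i \in J /\ h (y i) = 0) /\ x = \sum_i t i *: y i.
Proof.
move=> hx /ideal_mulP[n [t [y [tJ xE]]]].
have [|p [V [w [tV yE]]]] :=
    @trivN 1 n (\row_i t i) (fun i => h (y i)).
  move=> i0; rewrite -[RHS]hx xE raddf_sum; apply: eq_bigr => i _.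
  by rewrite mxE /= linearZ.
have [w' w'E] := choice (fun l => surj_h (w l)).
exists n, t, (fun i => y i - \sum_l V i l *: w' l); split=> [i|].
  split=> //; rewrite raddfB /= yE raddf_sum /=; apply/eqP.
  by rewrite subr_eq0; apply/eqP/eq_bigr => l _; rewrite /= linearZ w'E.
under eq_bigr => i _ do rewrite scalerBr scaler_sumr.
rewrite sumrB -xE exchange_big big1 ?subr0 // => l _.
under eq_bigr => i _ do rewrite scalerA.
rewrite -scaler_suml; suff -> : \sum_i t i * V i l = 0 by rewrite scale0r.
move/matrixP/(_ 0 l): tV; rewrite !mxE => {2}<-.
by apply: eq_bigr => i _; rewrite mxE.
Qed.

(** A relation in the kernel is trivialised in [L] by elements [w_l]; applying
    [h] gives relations between the [h (w_l)], whose trivialisation in [N]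
    lifts to corrections that bring the [w_l] into the kernel. *)
Lemma kernel_relations_trivial (Z : lmodType A) (i : {linear Z -> L}) :
  injective i -> (forall x, h x = 0 <-> exists z, x = i z) -> relations_trivial Z.
Proof.
move=> inj_i ker_h m n U z Uz.
have [|p [V [w [UV zE]]]] := @trivL m n U (fun j => i (z j)).
  move=> l; have := congr1 i (Uz l); rewrite raddf0 raddf_sum => E; rewrite -[RHS]E.
  by apply: eq_bigr => j _; rewrite /= linearZ.
have [|q [V' [v [VV' wE]]]] := @trivN n p V (fun l => h (w l)).
  move=> j; have hz : h (i (z j)) = 0 by apply/ker_h; exists (z j).
  rewrite -[RHS]hz zE raddf_sum.
  by apply: eq_bigr => l _; rewrite /= linearZ.
have [v' v'E] := choice (fun l => surj_h (v l)).
have /choice[w' w'E] l : exists w', w l - \sum_l' V' l l' *: v' l' = i w'.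
  apply/ker_h; rewrite raddfB /= wE raddf_sum /=; apply/eqP.
  by rewrite subr_eq0; apply/eqP/eq_bigr => l' _; rewrite /= linearZ v'E.
exists p, V, w'; split=> // j.
apply: inj_i; rewrite zE raddf_sum /=.
under [RHS]eq_bigr => l _ do rewrite linearZ /= -w'E scalerBr scaler_sumr.
rewrite sumrB exchange_big [X in _ - X]big1 ?subr0 // => l' _.
under eq_bigr => l _ do rewrite scalerA.
rewrite -scaler_suml; suff -> : \sum_l V j l * V' l l' = 0 by rewrite scale0r.
by move/matrixP/(_ j l'): VV'; rewrite !mxE.
Qed.

End Syzygy.

(** * Base change and reduction modulo an ideal *)

Section BaseChangeUniversal.
Variables (A : comNzRingType) (B : comPzRingType) (f : {rmorphism A -> B}).
Variables (M : lmodType A) (Q : lmodType B) (h : {linear M -> restr f Q}).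

Let bil (x : M) (b : restr f B^o) : restr f Q := (b : B) *: (h x : Q).

Let bilDl x x' b : bil (x + x') b = bil x b + bil x' b.
Proof. by rewrite /bil raddfD [LHS]scalerDr. Qed.

Let bilDr x b b' : bil x (b + b') = bil x b + bil x b'.
Proof. by rewrite /bil [LHS]scalerDl. Qed.

Let bilZl a x b : bil (a *: x) b = a *: bil x b.
Proof. by rewrite /bil linearZ /= [LHS]scalerA mulrC -[LHS]scalerA. Qed.

Let bilZr a x b : bil x (a *: b) = a *: bil x b.
Proof. by rewrite /bil -[LHS]scalerA. Qed.

(** The map that corresponds to [h] under the adjunction between extension and
    restriction of scalars. *)
Definition base_change_lift : base_change f M -> Q := tensor_lift bil.

Lemma base_change_liftE x b : base_change_lift (tens x b) = (b : B) *: (h x : Q).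
Proof. exact: (tensor_liftE bilDl bilDr bilZl bilZr). Qed.

Lemma base_change_lift_linear : linear base_change_lift.
Proof.
have lin := tensor_lift_linear bilDl bilDr bilZl bilZr.
have liftD u v : base_change_lift (u + v) = base_change_lift u + base_change_lift v.
  by have := lin 1 u v; rewrite !scale1r.
have lift0 : base_change_lift 0 = 0 by apply: (addrI (base_change_lift 0)); rewrite -liftD !addr0.
move=> b u v; rewrite liftD; congr (_ + _).
elim/tensor_ind: u => [x c||u u' IHu IHu'].
- have -> : b *: (tens x c : base_change f M) = tens x (b * (c : B) : restr f B^o).
    exact: tensor_mapE.
  by rewrite !base_change_liftE scalerA.
- by rewrite scaler0 lift0 scaler0.
- by rewrite scalerDr !liftD IHu IHu' scalerDr.
Qed.
HB.instance Definition _ := GRing.isLinear.Build B (base_change f M) Q *:%R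
  base_change_lift base_change_lift_linear.

End BaseChangeUniversal.

Section Coordinates.
Variables (A : pzRingType) (M : lmodType A) (K : choiceType).
Variables (e : K -> M) (coord : K -> {linear M -> A^o}).

(** A spanning family with a dual family of functionals is a basis. *)
Lemma coord_basis :
  (forall x y, coord x (e y) = (x == y)%:R) -> (forall u, u \in span (range e)) ->
  is_basis (range e).
Proof.
move=> coordE spanE; split=> // s c uniq_s se sum0 b0 sb0.
have /choice[xs xsE] (b : M) : exists x : K, b \in s -> e x = b.
  case: (boolP (b \in s)) => [/se [x _ <-]|_]; first by exists x.
  by have [x _ _] := se _ sb0; exists x.
have coordS b : b \in s -> coord (xs b0) (c b *: b) = c b * (xs b0 == xs b)%:R.
  by move=> sb; rewrite -coordE (xsE b sb) linearZ.
have := congr1 (coord (xs b0)) sum0; rewrite raddf0 raddf_sum (bigD1_seq b0) //=.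
rewrite coordS // eqxx mulr1 big_seq_cond big1 ?addr0 // => b /andP[sb bb0].
rewrite coordS //; case: eqP => [E|_]; last exact: mulr0.
by rewrite -(xsE b sb) -E xsE ?eqxx in bb0.
Qed.

End Coordinates.

Section FreegBasis.
Variables (A : comNzRingType) (K : choiceType).

Lemma freeg_coeff_linear (x : K) :
  linear (coeff x : {freeg K / A} -> A^o).
Proof. by move=> a D E; rewrite coeffD coeffZ. Qed.
HB.instance Definition _ x := GRing.isLinear.Build A {freeg K / A} A^o *:%R
  (coeff x) (freeg_coeff_linear x).

(** [freeg K] is free on the one-point divisors, with their coefficients as
    dual functionals. *)
Lemma freeg_free : free_module {freeg K / A}.
Proof.
exists (range (fun x => << x >>)).
apply: (coord_basis (coord := fun x => coeff x)).
  by move=> x y; rewrite /= coeffU mul1r eq_sym.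
move=> D; rewrite -[D]freeg_sumE; apply: rpred_sum => x _.
have -> : << coeff x D *g x >> = coeff x D *: << x >> :> {freeg K / A}.
  by apply/eqP/freeg_eqP => y; rewrite coeffZ !coeffU mul1r.
by apply/rpredZ/mem_span; exists x.
Qed.

End FreegBasis.

Section Reduction.
Variables (R : comNzRingType) (I : ideal R).
Local Notation pi := (quotring_pi I).

Section Module.
Variable L : lmodType R.

Definition reduce (x : L) : base_change pi L := tens x (1 : restr pi (quotring I)^o).

Lemma reduceD x y : reduce (x + y) = reduce x + reduce y.
Proof. exact: tensDl. Qed.

Lemma reduceZ r x : reduce (r *: x) = pi r *: reduce x.
Proof.
rewrite /reduce tensZl -tensZr; apply/esym; apply: etrans (tensor_mapE _ _ _ _) _.
by [].
Qed.

Lemma reduceB x y : reduce (x - y) = reduce x - reduce y.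
Proof.
have -> : x - y = x + (-1) *: y by rewrite scaleN1r.
by rewrite reduceD reduceZ rmorphN1 scaleN1r.
Qed.

Lemma reduce_tens r x : tens x (pi r : restr pi (quotring I)^o) = reduce (r *: x).
Proof.
rewrite /reduce tensZl -tensZr; congr tens.
by apply/esym; apply: mulr1.
Qed.

Lemma reduce_surj u : exists x, u = reduce x.
Proof.
elim/tensor_ind: u => [x b||_ _ [x ->] [y ->]].
- have [r <-] := quotring_pi_surj (b : quotring I).
  by exists (r *: x); rewrite reduce_tens.
- by exists 0; rewrite /reduce tens0l.
- by exists (x + y); rewrite reduceD.
Qed.

Let bil (x : L) (b : restr pi (quotring I)^o) : quotmod (ideal_mul I L) :=
  quotmod_pi _ ((repr (b : quotmod I) : R) *: x).

Let bilE x r : bil x (pi r : quotring I) = quotmod_pi _ (r *: x).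
Proof.
apply/eqP; rewrite quotmod_piE -scalerBl; apply: mem_ideal_mul.
by rewrite -quotring_piE; apply/eqP/(reprK (pi r : quotmod I)).
Qed.

Let bilDl x x' b : bil (x + x') b = bil x b + bil x' b.
Proof. by rewrite /bil scalerDr raddfD. Qed.

Let bilDr x b b' : bil x (b + b') = bil x b + bil x b'.
Proof.
have [r <-] := quotring_pi_surj (b : quotring I).
have [r' <-] := quotring_pi_surj (b' : quotring I).
have -> : (pi r : restr pi (quotring I)^o) + (pi r' : restr pi (quotring I)^o) =
    (pi (r + r') : quotring I) by rewrite raddfD.
by rewrite !bilE scalerDl raddfD.
Qed.

Let bilZl a x b : bil (a *: x) b = a *: bil x b.
Proof. by rewrite /bil -[RHS]linearZ; congr quotmod_pi; rewrite /= !scalerA [in RHS]mulrC. Qed.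

Let bilZr a x b : bil x (a *: b) = a *: bil x b.
Proof.
have [r <-] := quotring_pi_surj (b : quotring I).
have -> : a *: (pi r : restr pi (quotring I)^o) = (pi (a * r) : quotring I).
  exact: (esym (rmorphM pi a r)).
by rewrite !bilE -linearZ /= scalerA.
Qed.

(** [x (x) b |-> b x] is a well defined map from the base change to [L / I L],
    and it sends [reduce x] to the class of [x]. *)
Lemma reduce_eq0 x : reduce x = 0 <-> x \in ideal_mul I L.
Proof.
split=> [x0|/ideal_mulP[n [t [y [tI ->]]]]]; last first.
  have -> : reduce (\sum_i t i *: y i) = \sum_i reduce (t i *: y i).
    exact: (big_morph reduce reduceD (tens0l _ _)).
  apply: big1 => i _; rewrite reduceZ.
  suff -> : pi (t i) = 0 by rewrite scale0r.
  by apply/eqP; rewrite -(raddf0 pi) quotring_piE subr0.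
have := tensor_liftE bilDl bilDr bilZl bilZr x (pi 1 : quotring I).
have lin := tensor_lift_linear bilDl bilDr bilZl bilZr.
rewrite -/(reduce x) x0 bilE scale1r.
have -> : tensor_lift bil 0 = 0.
  have := lin 1 0 0; rewrite !scale1r addr0 => /eqP.
  by rewrite eq_sym -subr_eq0 addrK => /eqP.
by move/esym/eqP; rewrite -(raddf0 (quotmod_pi _)) quotmod_piE subr0.
Qed.

End Module.

Lemma base_change_map_reduce (L L' : lmodType R) (h : {linear L -> L'}) x :
  base_change_map pi h (reduce x) = reduce (h x).
Proof. exact: tensor_mapE. Qed.

Variable K : choiceType.

Let pi_coeff (x : K) (D : {freeg K / R}) : restr pi (quotring I)^o := pi (coeff x D).

Let pi_coeff_linear x : linear (pi_coeff x).
Proof. by move=> a D E; rewrite /pi_coeff coeffD coeffZ raddfD /= rmorphM. Qed.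
HB.instance Definition _ x := GRing.isLinear.Build R {freeg K / R}
  (restr pi (quotring I)^o) *:%R (pi_coeff x) (pi_coeff_linear x).

(** The coefficients of a divisor extend to functionals on the base change that
    are dual to the reduced one-point divisors. *)
Lemma base_change_freeg : free_module (base_change pi {freeg K / R}).
Proof.
pose point (x : K) : base_change pi {freeg K / R} := reduce (<< x >> : {freeg K / R}).
pose coord (x : K) : {linear base_change pi {freeg K / R} -> (quotring I)^o} :=
  base_change_lift (pi_coeff x).
exists (range point); apply: (coord_basis (e := point) (coord := coord)).
  move=> x y; rewrite /= base_change_liftE /= /pi_coeff coeffU mul1r eq_sym.
  by rewrite /GRing.scale /= mul1r rmorph_nat.
move=> u; have [D ->] := reduce_surj u; rewrite -[D]freeg_sumE.
rewrite (big_morph _ (@reduceD _) (tens0l _ _)); apply: rpred_sum => x _.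
have -> : << coeff x D *g x >> = coeff x D *: << x >> :> {freeg K / R}.
  by apply/eqP/freeg_eqP => y; rewrite coeffZ !coeffU mul1r.
by rewrite reduceZ; apply/rpredZ/mem_span; exists x.
Qed.

End Reduction.

(** * Residue fields and powers of an ideal *)

Lemma additive_of (U V : zmodType) (f : U -> V) :
  zmod_morphism f -> exists g : {additive U -> V}, g =1 f.
Proof.
move=> fB.
by exists (HB.pack_for {additive U -> V} f (GRing.isZmodMorphism.Build U V f fB)).
Qed.

Lemma rmorphism_of (A B : pzRingType) (f : A -> B) :
  (forall x y, f (x - y) = f x - f y) -> f 1 = 1 ->
  (forall x y, f (x * y) = f x * f y) ->
  exists g : {rmorphism A -> B}, g =1 f.
Proof.
move=> fB f1 fM.
by exists (HB.pack_for {rmorphism A -> B} f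
  (GRing.isZmodMorphism.Build A B f fB)
  (GRing.isMonoidMorphism.Build A B f (conj f1 fM))).
Qed.

Lemma lrmorphism_of (k : fieldType) (A B : algType k) (f : A -> B) :
  (forall x y, f (x - y) = f x - f y) -> f 1 = 1 ->
  (forall x y, f (x * y) = f x * f y) -> (forall c x, f (c *: x) = c *: f x) ->
  exists g : {lrmorphism A -> B}, g =1 f.
Proof.
move=> fB f1 fM fZ.
by exists (HB.pack_for {lrmorphism A -> B} f
  (GRing.isZmodMorphism.Build A B f fB)
  (GRing.isMonoidMorphism.Build A B f (conj f1 fM))
  (GRing.isScalable.Build k A B *:%R f fZ)).
Qed.

Section Residue.
Variables (k : fieldType) (R : comAlgType k) (m : ideal R).

(** The residue of [x] is the scalar [c] with [x - c] in [m]. *)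
Lemma kalgebra_residue : is_kalgebra m ->
  exists2 rho : {rmorphism R -> k},
    (forall c, rho c%:A = c) & (forall x, rho x = 0 <-> x \in m).
Proof.
case=> maxm [G GK KG].
pose rho x := G (quotring_pi m x).
have rhoE x : x - (rho x)%:A \in m by rewrite -quotring_piE [X in _ == X]KG.
have uniq_res (c d : k) : (c - d)%:A \in m -> c = d.
  by move=> cd; apply: (can_inj GK); apply/eqP; rewrite quotring_piE -scalerBl.
have rho_eq x (c : k) : x - c%:A \in m -> rho x = c.
  move=> xc; apply: uniq_res.
  have -> : (rho x - c)%:A = (x - c%:A) + (-1) * (x - (rho x)%:A).
    by rewrite mulN1r opprB scalerBl [RHS]addrC addrA subrK.
  by rewrite idealD ?idealMl.
have mN1 (x : R) : x \in m -> - x \in m by rewrite -mulN1r; apply: idealMl.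
have [|||g gE] := @rmorphism_of R k rho.
- move=> x y; apply: rho_eq.
  have -> : x - y - (rho x - rho y)%:A = (x - (rho x)%:A) + - (y - (rho y)%:A).
    by rewrite scalerBl !opprD !opprK addrACA.
  by rewrite idealD ?mN1.
- by apply: rho_eq; rewrite scale1r subrr ideal0.
- move=> x y; apply: rho_eq.
  have -> : x * y - (rho x * rho y)%:A =
      y * (x - (rho x)%:A) + (rho x)%:A * (y - (rho y)%:A).
    rewrite !mulrBr [y * x]mulrC [y * _]mulrC addrA subrK; congr (_ - _).
    by rewrite mulr_algl scalerA.
  by rewrite idealD ?idealMl.
exists g => [c|x]; rewrite gE.
  by apply: rho_eq; rewrite subrr ideal0.
split=> [rx0|mx]; first by have := rhoE x; rewrite rx0 scale0r subr0.
by apply: rho_eq; rewrite scale0r subr0.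
Qed.

End Residue.

Section IdealPowers.
Variables (A : comNzRingType) (m : ideal A).

Lemma ideal_expS n t s : t \in m -> s \in ideal_exp m n -> t * s \in ideal_exp m n.+1.
Proof. by move=> tm sn; apply: mem_span; exists t, s. Qed.

Lemma ideal_expSsub n : {subset ideal_exp m n.+1 <= ideal_exp m n}.
Proof. by apply: span_min => _ [t [s [_ sn ->]]]; apply: idealMl. Qed.

Lemma ideal_exp0 t : t \in ideal_exp m 0.
Proof. exact: mem_span. Qed.

Lemma ideal_exp_le i n : (n <= i)%N -> {subset ideal_exp m i <= ideal_exp m n}.
Proof.
move/subnK <-; elim: (_ - _)%N => // d IHd t /ideal_expSsub; exact: IHd.
Qed.

Lemma ideal_exp1 t : t \in m -> t \in ideal_exp m 1.
Proof. by move=> tm; rewrite -[t]mulr1; apply: ideal_expS => //; apply: ideal_exp0. Qed.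

Lemma ideal_mul_exp1 (M : lmodType A) (x : M) :
  (x \in ideal_mul (ideal_exp m 1) M) = (x \in ideal_mul m M).
Proof.
apply/idP/idP; apply: sub_ideal_mul => t; last exact: ideal_exp1.
apply: (span_min (N := m)) => _ [u [v [um _ ->]]]; rewrite mulrC; exact: idealMl.
Qed.

Lemma ideal_mul_expS (M : lmodType A) n (t : A) (x : M) :
  t \in ideal_exp m n -> x \in ideal_mul m M -> t *: x \in ideal_mul (ideal_exp m n.+1) M.
Proof.
move=> tn /ideal_mulP[p [s [y [sm ->]]]]; rewrite scaler_sumr.
apply: rpred_sum => i _; rewrite scalerA mulrC; apply: mem_ideal_mul.
exact: ideal_expS.
Qed.

End IdealPowers.

(** * From a lifting to a retraction *)

Section Lifting.
Variables (k : fieldType) (T : comAlgType k) (m : ideal T).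
Variable rho : {rmorphism T -> k}.
Hypotheses (rho_scalar : forall c, rho c%:A = c) (rho_eq0 : forall x, rho x = 0 <-> x \in m).

Let rhoE t : t - (rho t)%:A \in m.
Proof. by apply/rho_eq0; rewrite rmorphB /= rho_scalar subrr. Qed.

Variables (M1 M0 : lmodType T) (d : {linear M1 -> M0}).
Hypothesis trivM0 : relations_trivial M0.

(** The equational form of the flatness of [M0 / J M0] over [T / J]: move the
    right-hand side of [sum_i s_i x_i = sum_i r_i u_i], with the [r_i] in [J],
    to the left and trivialise. *)
Lemma relation_modulo (J : ideal T) p (s : 'I_p -> T) (x : 'I_p -> M0) :
  \sum_i s i *: x i \in ideal_mul J M0 ->
  exists l (W : 'M[T]_(p, l)) (w : 'I_l -> M0),
    (forall j, \sum_i s i * W i j \in J) /\ forall i, x i = \sum_j W i j *: w j.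
Proof.
case/ideal_mulP=> q [r [u [rJ sxE]]].
have [|l [V [w [srV xuE]]]] := @trivM0 1 (p + q) (row_mx (\row_i s i) (\row_i - r i))
    (fun i => match split i with inl i => x i | inr i => u i end).
  move=> i0; rewrite big_split_ord /=.
  under eq_bigr => i _ do rewrite (unsplitK (inl i)) row_mxEl mxE.
  under [X in _ + X]eq_bigr => i _ do rewrite (unsplitK (inr i)) row_mxEr mxE scaleNr.
  by rewrite sumrN sxE subrr.
exists l, (usubmx V), w; split=> [j|i].
  move/matrixP/(_ 0 j): srV; rewrite -[V]vsubmxK mul_row_col !mxE => /eqP.
  rewrite addr_eq0 => /eqP; under eq_bigr => i _ do rewrite mxE.
  rewrite col_mxKu => ->; rewrite -sumrN; apply: rpred_sum => i _.
  by rewrite !mxE mulNr opprK mulrC; apply: idealMl.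
have := xuE (lshift q i); rewrite (unsplitK (inl i)) => ->.
by apply: eq_bigr => j _; rewrite mxE.
Qed.

Hypothesis exact1 : forall y, d y \in ideal_mul m M0 ->
  exists2 z, d z = 0 & y - z \in ideal_mul m M1.

(** By induction [y] is [sum_j s_j x_j] modulo [ker d], with the [s_j] in
    [m^n], and the relation [sum_j s_j d(x_j) = 0] modulo [m^n.+1] is trivial
    through a matrix [W].  Let [b] be the residue of [W] and [P] a projector
    onto the column space of [b].  The combinations of the [x_j] with
    coefficients [1 - P] have differential in [m M0], so [exact1] moves them
    into [m M1] modulo [ker d].  Those with coefficients [P] contribute to [y]
    an element of [m^n.+1 M1], because [s b] vanishes modulo [m^n.+1] like [s W]
    and [P] is a right multiple of [b]. *)
Lemma kernel_adic n y : d y \in ideal_mul (ideal_exp m n) M0 ->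
  exists2 z, d z = 0 & y - z \in ideal_mul (ideal_exp m n) M1.
Proof.
elim: n y => [|n IHn] y dy.
  exists 0; first exact: raddf0.
  by rewrite subr0 -[y]scale1r; apply/mem_ideal_mul/ideal_exp0.
have [|z dz /ideal_mulP[p [s [x [sn yzE]]]]] := IHn y.
  exact: sub_ideal_mul (@ideal_expSsub _ _ _) _ dy.
have dysE : d y = \sum_i s i *: d (x i).
  rewrite -[y](subrK z) raddfD /= dz addr0 yzE raddf_sum.
  by apply: eq_bigr => i _; rewrite /= linearZ.
have [|l [W [w [sW dxWE]]]] := @relation_modulo (ideal_exp m n.+1) p s (fun i => d (x i)).
  by rewrite -dysE.
pose b := map_mx rho W.
(* The generalised inverse of [b] gives [P b = b]. *)
pose P := b *m pinvmx b.
have Pb : P *m b = b by apply: mulmxKpV.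
have sb j : \sum_i s i * (b i j)%:A \in ideal_exp m n.+1.
  have -> : \sum_i s i * (b i j)%:A =
      \sum_i s i * W i j - \sum_i s i * (W i j - (rho (W i j))%:A).
    rewrite -sumrB; apply: eq_bigr => i _; rewrite -mulrBr mxE.
    by rewrite opprB addrC subrK.
  apply: rpredB => //; apply: rpred_sum => i _; rewrite mulrC.
  exact: ideal_expS.
have sP j : \sum_i s i * (P i j)%:A \in ideal_exp m n.+1.
  have -> : \sum_i s i * (P i j)%:A =
      \sum_h (pinvmx b h j)%:A * \sum_i s i * (b i h)%:A.
    under [RHS]eq_bigr => h _ do rewrite mulr_sumr.
    rewrite exchange_big; apply: eq_bigr => i _; rewrite mxE scaler_suml mulr_sumr.
    by apply: eq_bigr => h _; rewrite mulrCA; congr (_ * _); rewrite mulr_algl scalerA mulrC.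
  by apply: rpred_sum => h _; apply: idealMl.
pose u' j := x j - \sum_i (P j i)%:A *: x i.
have /choice[z' z'P] j : exists z', d z' = 0 /\ u' j - z' \in ideal_mul m M1.
  have [|z' dz' uz'] := @exact1 (u' j); last by exists z'.
  rewrite raddfB raddf_sum /= dxWE.
  have -> : \sum_i d ((P j i)%:A *: x i) = \sum_h (\sum_i (P j i)%:A * W i h) *: w h.
    under [RHS]eq_bigr => h _ do rewrite scaler_suml.
    rewrite exchange_big; apply: eq_bigr => i _; rewrite linearZ /= dxWE scaler_sumr.
    by apply: eq_bigr => h _; rewrite scalerA.
  rewrite -sumrB; apply: rpred_sum => h _; rewrite -scalerBl; apply: mem_ideal_mul.
  have Pbjh : rho (W j h) = \sum_i P j i * b i h.
    by move/matrixP/(_ j h): Pb; rewrite [in LHS]mxE [b j h]mxE => <-.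
  apply/rho_eq0; rewrite rmorphB raddf_sum /= Pbjh.
  apply/eqP; rewrite subr_eq0; apply/eqP/eq_bigr => i _.
  by rewrite rmorphM /= rho_scalar [b i h]mxE.
exists (z + \sum_j s j *: z' j).
  rewrite raddfD /= dz add0r raddf_sum big1 // => j _.
  by rewrite /= linearZ /= (z'P j).1 scaler0.
have -> : y - (z + \sum_j s j *: z' j) =
    \sum_j s j *: (u' j - z' j) + \sum_i (\sum_j s j * (P j i)%:A) *: x i.
  under [X in _ = _ + X]eq_bigr => i _ do rewrite scaler_suml.
  rewrite exchange_big -big_split opprD addrA yzE -sumrB; apply: eq_bigr => j _ /=.
  under [X in _ = _ + X]eq_bigr => i _ do rewrite -scalerA.
  rewrite -scaler_sumr -scalerBr -scalerDr; congr (_ *: _).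
  by rewrite addrAC subrK.
apply: rpredD; apply: rpred_sum => j _; last exact: mem_ideal_mul.
by apply: ideal_mul_expS; first exact: sn; exact: (z'P j).2.
Qed.

Variables (eps : {additive M0 -> k}) (e : M0).
Hypotheses (epsZ : forall t x, eps (t *: x) = rho t * eps x) (eps1 : eps e = 1).
Hypothesis epsd : forall y, eps (d y) = 0.

(** By induction [t] lies in [m^n], and by [kernel_adic] the relation reads
    [t e - sum_j s_j d(x_j) = 0] modulo [m^n.+1] with the [s_j] in [m^n].  Being
    trivial, it survives any functional on the trivialising elements; for
    [eps] it becomes [t c0 = sum_j s_j c_j] modulo [m^n.+1], where [c0] has
    residue [eps e = 1] and [c_j] has residue [eps (d (x_j)) = 0]. *)
Lemma generator_free n t y :
  t *: e - d y \in ideal_mul (ideal_exp m n) M0 -> t \in ideal_exp m n.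
Proof.
elim: n t y => [|n IHn] t y tey; first exact: ideal_exp0.
have tn : t \in ideal_exp m n.
  by apply: (IHn t y); apply: sub_ideal_mul (@ideal_expSsub _ _ _) _ tey.
have [|z dz /ideal_mulP[p [s [x [sn yzE]]]]] := @kernel_adic n y.
  rewrite -[d y](subKr (t *: e)); apply: rpredB; first exact: mem_ideal_mul.
  exact: sub_ideal_mul (@ideal_expSsub _ _ _) _ tey.
have dysE : d y = \sum_i s i *: d (x i).
  rewrite -[y](subrK z) raddfD /= dz addr0 yzE raddf_sum.
  by apply: eq_bigr => i _; rewrite /= linearZ.
(* The relation with [t] and [e] put in front of the [- s_j] and [d (x_j)]. *)
pose s' (i : 'I_p.+1) := if unlift ord0 i is Some j then - s j else t.
pose x' (i : 'I_p.+1) := if unlift ord0 i is Some j then d (x j) else e.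
have [|l [W [w [sW xWE]]]] := @relation_modulo (ideal_exp m n.+1) p.+1 s' x'.
  rewrite big_ord_recl /s' /x' unlift_none.
  under eq_bigr => i _ do rewrite liftK scaleNr.
  by rewrite sumrN -dysE.
pose c i := \sum_j W i j * (eps (w j))%:A.
have rho_c i : rho (c i) = eps (x' i).
  rewrite xWE !raddf_sum; apply: eq_bigr => j _.
  by rewrite /= rmorphM /= rho_scalar epsZ.
have -> : t = t * (1 - c ord0) + \sum_i s' i * c i + \sum_i s i * c (fintype.lift ord0 i).
  rewrite big_ord_recl /s' unlift_none -!addrA.
  under [X in _ + (_ + (X + _))]eq_bigr => i _ do rewrite liftK mulNr.
  by rewrite sumrN addNr addr0 -mulrDr subrK mulr1.
apply: rpredD; first apply: rpredD.
- rewrite mulrC; apply: ideal_expS => //; apply/rho_eq0.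
  by rewrite rmorphB rmorph1 rho_c /x' unlift_none eps1 subrr.
- under eq_bigr => i _ do rewrite mulr_sumr.
  rewrite exchange_big; apply: rpred_sum => j _ /=.
  under eq_bigr => i _ do rewrite mulrA mulrC.
  by rewrite -mulr_sumr; apply: idealMl.
- apply: rpred_sum => i _; rewrite mulrC; apply: ideal_expS => //; apply/rho_eq0.
  by rewrite rho_c /x' liftK.
Qed.

Hypothesis exact0 : forall x, eps x = 0 -> exists y, x - d y \in ideal_mul m M0.

(** Successive approximation: an error [sum_i s_i x_i] with the [s_i] in [m^n]
    is improved by the case [n = 1], which is [exact0], for each [x_i]. *)
Lemma generator_spans n x :
  exists t y, x - t *: e - d y \in ideal_mul (ideal_exp m n) M0.
Proof.
elim: n x => [|n IHn] x.
  exists 0, 0; rewrite scale0r subr0 raddf0 subr0 -[x]scale1r.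
  by apply/mem_ideal_mul/ideal_exp0.
have [t [y /ideal_mulP[p [s [x' [sn xE]]]]]] := IHn x.
have /choice[y' y'P] i : exists y, x' i - (eps (x' i))%:A *: e - d y \in ideal_mul m M0.
  by apply: exact0; rewrite raddfB /= epsZ rho_scalar eps1 mulr1 subrr.
exists (t + \sum_i s i * (eps (x' i))%:A), (y + \sum_i s i *: y' i).
have -> : x - (t + \sum_i s i * (eps (x' i))%:A) *: e - d (y + \sum_i s i *: y' i) =
    \sum_i s i *: (x' i - (eps (x' i))%:A *: e - d (y' i)).
  rewrite raddfD raddf_sum scalerDl scaler_suml /=.
  under [RHS]eq_bigr => i _ do rewrite !scalerBr scalerA -linearZ.
  rewrite !sumrB -xE !opprD !addrA; congr (_ - _).
  by rewrite addrAC.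
by apply: rpred_sum => i _; apply: ideal_mul_expS.
Qed.

End Lifting.

Section IdealExtension.
Variables (A B : comNzRingType) (phi : {rmorphism A -> B}) (J : ideal A).
Variable L : lmodType B.

Lemma restr_ideal_mulZ (b : B) (x : restr phi L) :
  x \in ideal_mul J (restr phi L) -> (b *: (x : L) : restr phi L) \in ideal_mul J (restr phi L).
Proof.
case/ideal_mulP=> n [t [y [tJ ->]]]; rewrite scaler_sumr; apply: rpred_sum => i _.
have -> : b *: (t i *: y i : L) = t i *: (b *: (y i : L) : restr phi L).
  transitivity (b *: (phi (t i) *: (y i : L))); first by [].
  by rewrite scalerA mulrC -scalerA.
exact: mem_ideal_mul.
Qed.

Lemma ideal_mul_extension (x : L) :
  (x \in ideal_mul (ideal_extension phi J) L) = (x \in ideal_mul J (restr phi L)).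
Proof.
apply/idP/idP=> /ideal_mulP[n [t [y [tJ ->]]]]; apply: rpred_sum => i _; last first.
  by apply: mem_ideal_mul; apply: mem_span; exists (t i).
have /spanP[s sJ ->] := tJ i; rewrite scaler_suml big_seq.
apply: rpred_sum => p /sJ[a aJ ->]; rewrite -[_ *: y i]scalerA.
by apply: restr_ideal_mulZ; apply: (mem_ideal_mul (M := restr phi L)).
Qed.

End IdealExtension.

Section Retraction.
Variables (k : fieldType) (R T : comAlgType k) (mR : ideal R) (mT : ideal T).
Variable phi : {lrmorphism T -> R}.

(** A homomorphism of [k]-algebras preserves the maximal ideals exactly when it
    preserves residues. *)
Lemma residue_hom (rhoR : {rmorphism R -> k}) (rhoT : {rmorphism T -> k}) :
  (forall c, rhoR c%:A = c) -> (forall x, rhoR x = 0 <-> x \in mR) ->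
  (forall c, rhoT c%:A = c) -> (forall x, rhoT x = 0 <-> x \in mT) ->
  kalgebra_hom mT mR phi <-> forall t, rhoR (phi t) = rhoT t.
Proof.
move=> rhoRA rhoR0 rhoTA rhoT0; split=> [hom t|rhoE t]; last first.
  by move/rhoT0; rewrite -rhoE => /rhoR0.
have /hom/rhoR0 : t - (rhoT t)%:A \in mT.
  by apply/rhoT0; rewrite rmorphB /= rhoTA subrr.
rewrite !rmorphB /= linearZ rmorph1 /= rhoRA => /eqP.
by rewrite subr_eq0 => /eqP.
Qed.

Variables (rhoR : {rmorphism R -> k}) (rhoT : {rmorphism T -> k}).
Hypotheses (rhoR_scalar : forall c, rhoR c%:A = c)
  (rhoR_eq0 : forall x, rhoR x = 0 <-> x \in mR)
  (rhoT_scalar : forall c, rhoT c%:A = c)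
  (rhoT_eq0 : forall x, rhoT x = 0 <-> x \in mT)
  (phi_hom : kalgebra_hom mT mR phi).
Hypothesis completeT : adic_complete mT.

Variables (L1 L0 : lmodType R) (d : {linear L1 -> L0}).
Local Notation M0 := (restr phi L0).
Local Notation M1 := (restr phi L1).
Hypothesis trivM0 : relations_trivial M0.
Hypothesis exact1 : forall y : M1, (d y : M0) \in ideal_mul mT M0 ->
  exists2 z : M1, d z = 0 & y - z \in ideal_mul mT M1.
Variables (eps : {additive L0 -> k}) (e : L0).
Hypotheses (epsZ : forall r x, eps (r *: x) = rhoR r * eps x) (eps1 : eps e = 1).
Hypothesis epsd : forall y, eps (d y) = 0.
Hypothesis exact0 : forall x, eps x = 0 ->
  exists y, (x - d y : M0) \in ideal_mul mT M0.

(** The submodule [d L1 + mT^n L0] is stable under [R], which is what turns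
    uniqueness of approximations into multiplicativity of [g] below. *)
Let cong n (x : L0) : Prop :=
  exists y, (x - d y : M0) \in ideal_mul (ideal_exp mT n) M0.

Let congD n x x' : cong n x -> cong n x' -> cong n (x + x').
Proof.
move=> [y xy] [y' xy']; exists (y + y').
by rewrite raddfD opprD addrACA; apply: rpredD.
Qed.

Let congZ n (r : R) x : cong n x -> cong n (r *: x).
Proof.
move=> [y xy]; exists (r *: y).
by rewrite linearZ -scalerBr; apply: restr_ideal_mulZ.
Qed.

Let congB n x x' : cong n x -> cong n x' -> cong n (x - x').
Proof. by move=> cx cx'; apply: congD => //; rewrite -scaleN1r; apply: congZ. Qed.

Let congT n t : t \in ideal_exp mT n -> cong n (phi t *: e).
Proof.
move=> tn; exists 0; rewrite raddf0 subr0.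
exact: (mem_ideal_mul (M := M0)).
Qed.

Let rhoE t : rhoR (phi t) = rhoT t.
Proof. by move: t; apply/residue_hom. Qed.

Let dT : {linear M1 -> M0} := restr_map phi d.

Let epsT : {additive M0 -> k} := eps.

Let epsTZ (t : T) (x : M0) : epsT (t *: x) = rhoT t * epsT x.
Proof. by rewrite -rhoE; apply: epsZ. Qed.

Let eps_ideal_mul (x : M0) : x \in ideal_mul mT M0 -> epsT x = 0.
Proof.
case/ideal_mulP=> n [t [y [tT ->]]]; rewrite raddf_sum big1 // => i _.
have t0 : rhoT (t i) = 0 by apply/rhoT_eq0.
by rewrite /= epsTZ t0 mul0r.
Qed.

Let cong_free n t : cong n (phi t *: e) -> t \in ideal_exp mT n.
Proof.
move=> [y yE].
exact: (generator_free rhoT_scalar rhoT_eq0 (d := dT) trivM0 exact1 epsTZ eps1 epsd yE).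
Qed.

Let cong_spans n x : exists t, cong n (x - phi t *: e).
Proof.
have [t [y yE]] := generator_spans rhoT_scalar (d := dT) epsTZ eps1 exact0 n x.
by exists t, y.
Qed.

(** For [r] in [R] the approximations [t_n] of [r e] form a Cauchy sequence by
    [cong_free]; [g r] is its limit. *)
Lemma lifting_retraction : has_retraction mT mR phi.
Proof.
have /choice[g gP] r : exists t, forall n, cong n (r *: e - phi t *: e).
  have /choice[u uP] n := cong_spans n (r *: e).
  have cauchy_u : adic_cauchy mT u.
    move=> n; exists n => i j ni nj; apply: cong_free.
    have cong_le i' : (n <= i')%N -> cong n (r *: e - phi (u i') *: e).
      move=> ni'; have [y yE] := uP i'; exists y.
      exact: sub_ideal_mul (ideal_exp_le ni') _ yE.
    have := congB (cong_le j nj) (cong_le i ni).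
    by rewrite rmorphB /= scalerBl opprB addrC addrA subrK.
  have [t tlim] := completeT.2 u cauchy_u; exists t => n.
  have [N Nt] := tlim n; pose i := maxn N n.
  have -> : r *: e - phi t *: e = (r *: e - phi (u i) *: e) + phi (u i - t) *: e.
    by rewrite rmorphB /= scalerBl addrA subrK.
  apply: congD; last by apply/congT/Nt/leq_maxl.
  have [y yE] := uP i; exists y.
  by apply: sub_ideal_mul (ideal_exp_le (leq_maxr N n)) _ yE.
have g_uniq r t : (forall n, cong n (r *: e - phi t *: e)) -> g r = t.
  move=> rt; apply/eqP; rewrite -subr_eq0; apply/eqP/(completeT.1) => n.
  apply: cong_free; have := congB (rt n) (gP r n).
  by rewrite rmorphB /= scalerBl opprB addrC addrA subrK.
have gphi t : g (phi t) = t.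
  by apply: g_uniq => n; rewrite subrr -(scale0r e) -(raddf0 phi); apply/congT/ideal0.
have [||||g' g'E] := @lrmorphism_of k R T g.
- move=> x y; apply: g_uniq => n.
  have -> : (x - y) *: e - phi (g x - g y) *: e =
      (x *: e - phi (g x) *: e) - (y *: e - phi (g y) *: e).
    by rewrite rmorphB /= !scalerBl !opprD !opprK addrACA.
  exact: congB.
- by rewrite -(rmorph1 phi) gphi.
- move=> x y; apply: g_uniq => n.
  have -> : (x * y) *: e - phi (g x * g y) *: e =
      x *: (y *: e - phi (g y) *: e) + phi (g y) *: (x *: e - phi (g x) *: e).
    rewrite rmorphM !scalerBr !scalerA [phi (g x) * _]mulrC [x * phi _]mulrC.
    by rewrite addrA subrK.
  by apply: congD; apply: congZ.
- move=> c x; apply: g_uniq => n.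
  have -> : (c *: x) *: e - phi (c *: g x) *: e = c%:A *: (x *: e - phi (g x) *: e).
    by rewrite [phi (c *: _)]linearZ /= scalerBr !scalerA !mulr_algl.
  exact: congZ.
exists g'; split=> //.
- move=> x mx; rewrite g'E; apply/rhoT_eq0.
  have [y] := gP x 1%N; rewrite ideal_mul_exp1 => /(@eps_ideal_mul _).
  rewrite !raddfB /= epsd subr0 !epsZ eps1 !mulr1 rhoE => /eqP.
  by rewrite subr_eq0 => /eqP <-; apply/rhoR_eq0.
- by move=> t t' /(congr1 g); rewrite !gphi.
- by move=> t; exists (phi t); rewrite g'E gphi.
- by move=> t; rewrite g'E gphi.
Qed.

End Retraction.

Section ResidueModule.
Variables (k : fieldType) (R : comAlgType k) (m I : ideal R).
Hypothesis sIm : {subset I <= m}.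

Definition residue_pi (r : R) : residue_module m I :=
  quotmod_pi (quot_ideal I m) (quotring_pi I r : (quotring I)^o).

Lemma residue_pi_surj q : exists r, residue_pi r = q.
Proof.
have [p <-] := quotmod_pi_surj q; have [r <-] := quotring_pi_surj (p : quotring I).
by exists r.
Qed.

Lemma residue_piB r s : residue_pi (r - s) = residue_pi r - residue_pi s.
Proof. by rewrite /residue_pi raddfB; apply: raddfB. Qed.

Lemma residue_piD r s : residue_pi (r + s) = residue_pi r + residue_pi s.
Proof. by rewrite /residue_pi raddfD; apply: raddfD. Qed.

Lemma residue_piZ r s : quotring_pi I r *: residue_pi s = residue_pi (r * s).
Proof. by rewrite /residue_pi rmorphM; apply/esym; apply: linearZ. Qed.

Lemma residue_pi_eq0 r : residue_pi r = 0 <-> r \in m.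
Proof.
split=> [/eqP|mr].
  rewrite -(raddf0 (quotmod_pi (quot_ideal I m))) quotmod_piE subr0 => /asboolP[x mx].
  move/eqP; rewrite quotring_piE => rxI.
  by rewrite -[r](subrK x); apply: idealD => //; apply: sIm.
apply/eqP; rewrite -(raddf0 (quotmod_pi (quot_ideal I m))) quotmod_piE subr0.
by apply/asboolP; exists r.
Qed.

(** The residue module is a one-dimensional [k]-vector space on the class of
    [1]. *)
Lemma residue_module_coord (rho : {rmorphism R -> k}) :
  (forall x, rho x = 0 <-> x \in m) ->
  exists2 kappa : {additive residue_module m I -> k},
    (forall r, kappa (residue_pi r) = rho r) & forall q, kappa q = 0 -> q = 0.
Proof.
move=> rho0; have /choice[s sE] := residue_pi_surj.
pose kap q := rho (s q).
have kapE r : kap (residue_pi r) = rho r.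
  apply/eqP; rewrite -subr_eq0 -rmorphB; apply/eqP/rho0/residue_pi_eq0.
  by rewrite residue_piB sE subrr.
have kapB : zmod_morphism kap.
  move=> p q; have [r <-] := residue_pi_surj p; have [r' <-] := residue_pi_surj q.
  by rewrite -residue_piB !kapE rmorphB.
have [kappa kappaE] := additive_of kapB.
exists kappa => [r|q]; first by rewrite kappaE kapE.
have [r <-] := residue_pi_surj q; rewrite kappaE kapE => /rho0.
by move/residue_pi_eq0.
Qed.

End ResidueModule.

(** The reduction of the lifting [L] is the given resolution of [k]; its
    exactness in degrees zero and one provides the hypotheses of
    [lifting_retraction], with the augmentation as [eps]. *)
Lemma retraction_of_liftable (k : fieldType) (R T : comAlgType k)
    (mR : ideal R) (mT : ideal T) (phi : {lrmorphism T -> R}) :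
  is_kalgebra mR -> is_kalgebra mT -> adic_complete mT ->
  kalgebra_hom mT mR phi -> flat_morphism phi ->
  liftable_module (residue_module mR (ideal_extension phi mT)) ->
  has_retraction mT mR phi.
Proof.
move=> kalgR kalgT completeT hom flat_phi.
set I := ideal_extension phi mT.
have [rhoR rhoRA rhoR0] := kalgebra_residue kalgR.
have [rhoT rhoTA rhoT0] := kalgebra_residue kalgT.
have sIm : {subset I <= mR}.
  by apply: (span_min (N := mR)) => _ [x /hom mx ->].
case=> F [[freeF [_ exactF [epsF [surjF kerF]]]] [L [freeL [f [bijf comf]]]]].
have [kappa kappaE kappa0] := residue_module_coord sIm rhoR0.
have red_eq0 (n : int) (x : L n) : f n (reduce I x) = 0 ->
    (x : restr phi (L n)) \in ideal_mul mT (restr phi (L n)).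
  move=> fx0; have : x \in ideal_mul I (L n).
    by apply/reduce_eq0/(bij_inj (bijf n)); rewrite fx0 raddf0.
  by rewrite ideal_mul_extension.
have f_surj (n : int) (u : F n) : exists x : L n, u = f n (reduce I x).
  have [h _ fK] := bijf n; have [x xE] := reduce_surj (h u).
  by exists x; rewrite -xE fK.
have f_diff (n : int) (x : L (1 + n)) :
    cdiff F n (f (1 + n) (reduce I x)) = f n (reduce I (cdiff L n x)).
  by rewrite -comf; congr (f n _); apply: base_change_map_reduce.
have eps_zmod : zmod_morphism (fun x : L 0 => kappa (epsF (f 0 (reduce I x)))).
  by move=> x y; rewrite reduceB !raddfB.
have [eps epsE] := additive_of eps_zmod.
have epsZ (r : R) (x : L 0) : eps (r *: x) = rhoR r * eps x.
  rewrite !epsE reduceZ !linearZ /=.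
  have [s <-] := residue_pi_surj (epsF (f 0 (reduce I x))).
  by rewrite residue_piZ !kappaE rmorphM.
have [e0 e0E] := surjF (residue_pi mR I 1).
have [e eE] := f_surj 0 e0.
have eps1 : eps e = 1 by rewrite epsE -eE e0E kappaE rmorph1.
apply: (lifting_retraction rhoRA rhoR0 rhoTA rhoT0 hom completeT
  (d := cdiff L 0) _ _ epsZ eps1).
- by apply: free_relations_trivial (freeL 0); apply: flat_relations_trivial.
- move=> y dy.
  have [||w wE] := exactF 0 _ (f (1 + 0) (reduce I y)) => //.
    rewrite f_diff.
    suff -> : reduce I (cdiff L 0 y) = 0 by rewrite raddf0.
    by apply/reduce_eq0; rewrite ideal_mul_extension.
  have [y' y'E] := f_surj _ w.
  exists (cdiff L (1 + 0) y'); first exact: cdiffK.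
  by apply: red_eq0; rewrite reduceB raddfB /= wE y'E f_diff subrr.
- move=> y; rewrite epsE -f_diff.
  suff -> : epsF (cdiff F 0 (f (1 + 0) (reduce I y))) = 0 by rewrite raddf0.
  by apply/kerF; exists (f (1 + 0) (reduce I y)).
- move=> x; rewrite epsE => /kappa0/kerF[w wE].
  have [y yE] := f_surj _ w; exists y; apply: red_eq0.
  by rewrite reduceB raddfB /= wE yE f_diff subrr.
Qed.

(** * From a retraction to a lifting *)

Section StandardResolution.
Variable R : comNzRingType.

(** The free module on all elements of [N], which avoids any choice of
    generators. *)
Definition cover (N : lmodType R) : {linear {freeg N / R} -> N} :=
  freeg_lift (fun x : N => x).

Lemma cover_surj (N : lmodType R) (y : N) : exists x, cover N x = y.
Proof. by exists << y >>; rewrite /= freeg_liftE scale1r. Qed.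

Variable M : lmodType R.

Fixpoint syzygy (n : nat) : lmodType R :=
  if n is n'.+1 then submodule (kernel (cover (syzygy n'))) else M.

Definition syzygy_diff (n : nat) :
    {linear {freeg (syzygy n.+1) / R} -> {freeg (syzygy n) / R}} :=
  (val : submodule (kernel (cover (syzygy n))) -> {freeg (syzygy n) / R})
    \o cover (syzygy n.+1).

Lemma syzygy_exact n x : cover (syzygy n) x = 0 <-> exists y, x = syzygy_diff n y.
Proof.
split=> [/kernelP x0|[y ->]]; last exact/kernelP/(valP (cover (syzygy n.+1) y)).
by have [y yE] := cover_surj (Sub x x0 : syzygy n.+1); exists y; rewrite /= yE.
Qed.

Lemma syzygy_diff_eq0 n y : syzygy_diff n y = 0 <-> cover (syzygy n.+1) y = 0.
Proof.
split=> [y0|y0]; last by rewrite /= [freeg_lift _ _]y0.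
by apply: val_inj; rewrite raddf0.
Qed.

(** Giving a set of generators in every degree makes all terms free, hence all
    their reductions, by one argument. *)
Definition resolution_index (n : int) : choiceType :=
  if n is Posz m then syzygy m else void.

Definition resolution_obj (n : int) : lmodType R := {freeg (resolution_index n) / R}.

Definition resolution_diff (n : int) :
    {linear resolution_obj (1 + n) -> resolution_obj n} :=
  match n with
  | Posz m => syzygy_diff m
  | Negz _ => \0
  end.

Lemma resolution_diffK n (x : resolution_obj (1 + (1 + n))) :
  resolution_diff n (resolution_diff (1 + n) x) = 0.
Proof.
case: n x => [n|n] x //=.
have /syzygy_diff_eq0 : cover (syzygy n.+1) (syzygy_diff n.+1 x) = 0.
  by apply/syzygy_exact; exists x.
by [].
Qed.

Definition standard_resolution : chain_complex R :=
  ChainComplex resolution_diffK.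

Lemma standard_resolution_free : free_complex standard_resolution.
Proof. by move=> n; apply: freeg_free. Qed.

Lemma resolution_obj_neg n (x : resolution_obj (Negz n)) : x = 0.
Proof. by rewrite -[x]freeg_sumE; apply: big1 => -[]. Qed.

End StandardResolution.

Section RetractionLifts.
Variables (k : fieldType) (R T : comAlgType k) (mR : ideal R) (mT : ideal T).
Variables (phi : {lrmorphism T -> R}) (g : {lrmorphism R -> T}).
Hypotheses (kalgR : is_kalgebra mR) (kalgT : is_kalgebra mT).
Hypothesis flat_phi : flat_morphism phi.
Hypothesis retr : is_retraction mT mR phi g.

Let gphi t : g (phi t) = t.
Proof. by case: retr. Qed.

Local Notation N0 := (restr g T^o : lmodType R).
Local Notation L := (standard_resolution N0).
Local Notation I := (ideal_extension phi mT).

Let triv_free (K : choiceType) : relations_trivial (restr phi {freeg K / R}).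
Proof.
apply: free_relations_trivial; last exact: freeg_free.
exact: flat_relations_trivial.
Qed.

(** Since [g] retracts [phi], restriction along [phi] turns the resolved module
    [N0] back into [T]. *)
Let triv_syzygy n : relations_trivial (restr phi (syzygy N0 n)).
Proof.
elim: n => [|n IHn] m p U z Uz.
  exists 1%N, (\matrix_(j, l) (z j : T)), (fun _ => 1 : T); split.
    apply/matrixP => i l; rewrite !mxE -[RHS](Uz i); apply: eq_bigr => j _.
    by rewrite mxE -[RHS]/(g (phi (U i j)) * z j : T) gphi.
  move=> j; rewrite big_ord1 mxE.
  by rewrite -[RHS]/(g (phi (z j)) * 1 : T) gphi mulr1.
pose h : {linear restr phi {freeg (syzygy N0 n) / R} -> restr phi (syzygy N0 n)} :=
  restr_map phi (cover (syzygy N0 n)).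
pose i : {linear restr phi (syzygy N0 n.+1) -> restr phi {freeg (syzygy N0 n) / R}} :=
  restr_map phi (val : submodule (kernel (cover (syzygy N0 n))) -> _).
apply: (kernel_relations_trivial (h := h) (i := i) (@triv_free _) IHn _ _ _ Uz).
- by move=> y; have [x xE] := cover_surj (y : syzygy N0 n); exists x.
- exact: val_inj.
- move=> x; split=> [/kernelP x0|[y ->]]; last exact: (kernelP _ _ (valP y)).
  by exists (Sub x x0 : submodule _).
Qed.

Let sIm : {subset I <= mR}.
Proof. by case: retr => hom _ _ _ _; apply: (span_min (N := mR)) => _ [x /hom mx ->]. Qed.

Let residue_congr (r s : R) : r - s \in mR -> residue_pi mR I r = residue_pi mR I s.
Proof.
move=> rs; apply/eqP; rewrite -subr_eq0 -residue_piB; apply/eqP.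
by apply/(residue_pi_eq0 sIm).
Qed.

Let phig (r : R) : phi (g r) - r \in mR.
Proof.
have [rhoR rhoRA rhoR0] := kalgebra_residue kalgR.
have [rhoT rhoTA rhoT0] := kalgebra_residue kalgT.
case: retr => /(residue_hom phi rhoRA rhoR0 rhoTA rhoT0) phiE.
move=> /(residue_hom g rhoTA rhoT0 rhoRA rhoR0) gE _ _ _.
by apply/rhoR0; rewrite rmorphB /= phiE gE subrr.
Qed.

(** Linear over [R] because [phi (g r)] and [r] have the same residue. *)
Let aug (t : N0) : restr (quotring_pi I) (residue_module mR I) :=
  residue_pi mR I (phi t).

Let aug_linear : linear aug.
Proof.
move=> a t t'; rewrite /aug.
have -> : residue_pi mR I (phi (a *: t + t' : N0)) =
    residue_pi mR I (a * phi t + phi t').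
  apply: residue_congr; rewrite -[phi _]/(phi (g a * t + t')) rmorphD rmorphM /=.
  by rewrite opprD addrACA subrr addr0 -mulrBl mulrC idealMl.
by rewrite residue_piD -residue_piZ.
Qed.
HB.instance Definition _ := GRing.isLinear.Build R N0
  (restr (quotring_pi I) (residue_module mR I)) *:%R aug aug_linear.

Let eps : {linear base_change (quotring_pi I) (L 0) -> residue_module mR I} :=
  base_change_lift (aug \o cover N0).

Let epsE (x : L 0) : eps (reduce I x) = residue_pi mR I (phi (cover N0 x)).
Proof.
by rewrite [LHS]base_change_liftE -[1 : quotring I]/(quotring_pi I 1) residue_piZ mul1r.
Qed.

(** If [d x] lies in [I] times the previous free module then it lies in [I]
    times its image, by [kernel_ideal_mul] and flatness of the syzygy below;
    subtracting a preimage changes [x] by an element that reduces to zero. *)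
Let reduced_exact n (x : {freeg (syzygy N0 n.+1) / R}) :
  reduce I (syzygy_diff N0 n x) = 0 -> exists y, reduce I x = reduce I (syzygy_diff N0 n.+1 y).
Proof.
move/reduce_eq0; rewrite ideal_mul_extension => dxI.
pose h : {linear restr phi {freeg (syzygy N0 n) / R} -> restr phi (syzygy N0 n)} :=
  restr_map phi (cover (syzygy N0 n)).
have dx_ker : h (syzygy_diff N0 n x) = 0 by apply/syzygy_exact; exists x.
have [|p [t [z [tz dxE]]]] := kernel_ideal_mul (h := h) (@triv_syzygy n) _ dx_ker dxI.
  by move=> y; have [x' xE] := cover_surj (y : syzygy N0 n); exists x'.
have /choice[u uE] i : exists u, z i = syzygy_diff N0 n u.
  by apply/syzygy_exact; exact: (tz i).2.
pose x' : {freeg (syzygy N0 n.+1) / R} := x - \sum_i phi (t i) *: u i.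
have /syzygy_exact[y yE] : cover (syzygy N0 n.+1) x' = 0.
  apply/syzygy_diff_eq0; rewrite raddfB raddf_sum.
  apply/eqP; rewrite subr_eq0 [X in X == _]dxE; apply/eqP/eq_bigr => i _.
  by rewrite [RHS]linearZ /= uE.
exists y; rewrite -yE; apply/eqP; rewrite -subr_eq0 -reduceB; apply/eqP/reduce_eq0.
rewrite /x' opprB addrC subrK; apply: rpred_sum => i _.
by apply: mem_ideal_mul; apply: mem_span; exists (t i); first exact: (tz i).1.
Qed.

(** If the augmentation of [x] is [t] in [mT], then [x - t e] is a boundary,
    where [e] is the generator over [1], and [t e] reduces to zero. *)
Let eps_kernel (x : {freeg N0 / R}) :
  residue_pi mR I (phi (cover N0 x)) = 0 <->
  exists y, reduce I x = reduce I (syzygy_diff N0 0 y).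
Proof.
split=> [|[y xyE]]; last first.
  rewrite -epsE xyE epsE; have -> : cover N0 (syzygy_diff N0 0 y) = 0.
    by apply/(@syzygy_exact _ N0 0); exists y.
  by apply/(residue_pi_eq0 sIm); rewrite raddf0 ideal0.
move/(residue_pi_eq0 sIm); set t : T := cover N0 x => tm.
have {}tm : t \in mT by rewrite -[t]gphi; case: retr => _ ghom _ _ _; apply: ghom.
pose e : {freeg N0 / R} := << (1 : T) >>.
have /(@syzygy_exact _ N0 0)[y yE] : cover N0 (x - phi t *: e) = 0.
  have eE : cover N0 (phi t *: e) = t.
    rewrite [LHS]linearZ /= [freeg_lift _ e]freeg_liftE scale1r.
    by rewrite -[LHS]/(g (phi t) * 1 : T) gphi mulr1.
  by rewrite [LHS]raddfB /= [freeg_lift _ (_ *: _)]eE subrr.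
exists y; rewrite -yE; apply/eqP; rewrite -subr_eq0 -reduceB; apply/eqP/reduce_eq0.
rewrite opprB addrC subrK.
by apply: mem_ideal_mul; apply: mem_span; exists t.
Qed.

Lemma retraction_liftable : liftable_module (residue_module mR I).
Proof.
exists (base_change_complex (quotring_pi I) L); split; last first.
  exists L; split; first exact: standard_resolution_free.
  exists (fun _ => idfun); split=> // n; by exists id.
split; first by move=> n; apply: base_change_freeg.
split.
- case=> // n _ u; have [x ->] := reduce_surj u.
  have -> : x = 0 by apply: resolution_obj_neg.
  exact: tens0l.
- case=> // n _ u; have [x ->] := reduce_surj u => dx0.
  have [y yE] := @reduced_exact n x (etrans (esym (base_change_map_reduce _ _ _)) dx0).
  exists (reduce I y); rewrite [LHS]yE; apply/esym; exact: base_change_map_reduce.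
- exists eps; split=> [q|u].
    have [r <-] := residue_pi_surj q.
    have [x xE] := cover_surj (g r : N0).
    exists (reduce I x); rewrite epsE xE; exact: residue_congr.
  have [x ->] := reduce_surj u; rewrite epsE; split=> [/eps_kernel[y yE]|[v vE]].
    by exists (reduce I y); rewrite [LHS]yE; apply/esym; apply: base_change_map_reduce.
  have [y yE] := reduce_surj v; apply/eps_kernel; exists y.
  by rewrite vE yE; apply: base_change_map_reduce.
Qed.

End RetractionLifts.

(** * Semi-fiber products *)

Section RingKernel.
Variables (A B : comPzRingType) (g : {rmorphism A -> B}).

Definition ring_kernel : {pred A^o} := fun x => g x == 0.

Lemma ring_kernelP x : reflect (g x = 0) (x \in ring_kernel).
Proof. exact: eqP. Qed.

Lemma ring_kernel_submod : submod_closed ring_kernel.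
Proof.
split=> [|a x y /ring_kernelP gx /ring_kernelP gy]; apply/ring_kernelP.
  exact: raddf0.
by rewrite rmorphD rmorphM gx gy mulr0 addr0.
Qed.
HB.instance Definition _ :=
  GRing.isSubmodClosed.Build A A^o ring_kernel ring_kernel_submod.

End RingKernel.

Section KPlus.
Variables (k : fieldType) (R : comAlgType k) (a : ideal R).

Lemma kplus_incl : exists iota : {lrmorphism kplus a -> R}, forall s, iota s = val s.
Proof.
apply: lrmorphism_of => [x y||x y|c x].
- by rewrite raddfB.
- by rewrite rmorph1.
- by rewrite rmorphM.
- by rewrite linearZ.
Qed.

Lemma kplus_kalgebra : 1 \notin a -> is_kalgebra (kplus_ideal a).
Proof.
move=> na1.
have scalar_a (c : k) : c%:A \in a -> c = 0.
  move=> ca; apply/eqP; apply: contraNT na1 => c0.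
  by rewrite -[1](scalerK c0) -mulr_algl; apply: idealMl.
have kplusE (s : kplus a) : exists c : k, s - c%:A \in kplus_ideal a.
  by have /kplus_predP[c cE] := valP s; exists c.
split; [split|].
- exact: na1.
- move=> J sJ nJ1 s Js; have [c cE] := kplusE s.
  have [c0|c0] := eqVneq c 0; first by move: cE; rewrite c0 scale0r subr0.
  have Jc : (c%:A : kplus a) \in J.
    have -> : (c%:A : kplus a) = s + (-1) * (s - c%:A) by rewrite mulN1r opprB addrC subrK.
    by apply: idealD => //; apply/idealMl/sJ.
  case/negP: nJ1; rewrite -[1](scalerK c0) -mulr_algl; exact: idealMl.
- have /choice[G GE] : forall q : quotring (kplus_ideal a),
      exists c : k, q = quotring_pi (kplus_ideal a) c%:A.
    move=> q; have [s <-] := quotring_pi_surj q; have [c cE] := kplusE s.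
    by exists c; apply/eqP; rewrite quotring_piE.
  exists G => [c|q]; last by rewrite -GE.
  have /eqP := GE (quotring_pi (kplus_ideal a) c%:A).
  rewrite quotring_piE -scalerBl => cG; apply/esym/eqP; rewrite -subr_eq0; apply/eqP.
  exact: scalar_a cG.
Qed.

End KPlus.

Section SemiFiber.
Variables (k : fieldType) (R T : comAlgType k) (mR : ideal R) (mT : ideal T).
Variable phi : {lrmorphism T -> R}.
Hypotheses (kalgR : is_kalgebra mR) (kalgT : is_kalgebra mT).
Hypothesis phi_hom : kalgebra_hom mT mR phi.

(** The retraction is the projection onto [T].  Elements with first component in
    [mT] go to [mR], so [theta (t, y)] and [t] have the same residue; hence the
    projection preserves the maximal ideals. *)
Lemma semi_fiber_retraction (S : comAlgType k) (mS : ideal S)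
    (star : bimodule_action T mS) (theta : {lrmorphism semi_fiber star -> R}) :
  bijective theta -> kalgebra_hom (semi_fiber_ideal star mT) mR theta ->
  (forall t, theta (semi_fiber_inl star t) = phi t) -> has_retraction mT mR phi.
Proof.
case=> psi thetaK psiK theta_hom thetaT.
have [rhoR rhoRA rhoR0] := kalgebra_residue kalgR.
have [rhoT rhoTA rhoT0] := kalgebra_residue kalgT.
pose g x : T := (psi x).1.
have psi_phi t : psi (phi t) = semi_fiber_inl star t by rewrite -thetaT thetaK.
have [||||g' g'E] := @lrmorphism_of k R T g.
- move=> x y; rewrite /g; have -> : psi (x - y) = psi x - psi y => //.
  by apply: (can_inj thetaK); rewrite psiK raddfB /= !psiK.
- by rewrite /g -(rmorph1 phi) psi_phi.
- move=> x y; rewrite /g; have -> : psi (x * y) = psi x * psi y => //.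
  by apply: (can_inj thetaK); rewrite psiK rmorphM /= !psiK.
- move=> c x; rewrite /g; have -> : psi (c *: x) = c *: psi x => //.
  by apply: (can_inj thetaK); rewrite psiK linearZ /= !psiK.
have gphi t : g' (phi t) = t by rewrite g'E /g psi_phi.
exists g'; split=> //.
- move=> x mx; have := psiK x; rewrite g'E /g.
  case: (psi x) => t y xE; rewrite /=; apply/rhoT0.
  pose c := rhoT t.
  have tc : t - c%:A \in mT by apply/rhoT0; rewrite rmorphB /= rhoTA subrr.
  have /rhoR0 : theta ((t - c%:A, y) : semi_fiber star) \in mR by apply: theta_hom.
  have -> : ((t - c%:A, y) : semi_fiber star) = (t, y) - semi_fiber_inl star c%:A.
    by apply: (congr2 pair); rewrite //= subr0.
  rewrite raddfB /= xE thetaT linearZ rmorph1 rmorphB /= rhoRA.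
  by move/rhoR0: mx => ->; rewrite sub0r => /eqP; rewrite oppr_eq0 => /eqP.
- by move=> t t' /(congr1 g'); rewrite !gphi.
- by move=> t; exists (phi t).
Qed.

End SemiFiber.

Section RetractionSemiFiber.
Variables (k : fieldType) (R T S : comAlgType k).
Variables (mR : ideal R) (mT : ideal T) (mS : ideal S).
Variables (phi : {lrmorphism T -> R}) (g : {lrmorphism R -> T}).
Variable iota : {lrmorphism S -> R}.
Hypothesis phi_hom : kalgebra_hom mT mR phi.
Hypothesis retr : is_retraction mT mR phi g.
Hypotheses (kalgR : is_kalgebra mR) (kalgT : is_kalgebra mT).
Hypotheses (iota_inj : injective iota)
  (kernel_g : forall x, g x = 0 <-> exists2 y, y \in mS & iota y = x).

Let gphi t : g (phi t) = t.
Proof. by case: retr. Qed.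

Let emb (y : submodule mS) : R := iota (val y).

Let emb_inj : injective emb.
Proof. by move=> y z yz; apply/val_inj/iota_inj. Qed.

Let embD y z : emb (y + z) = emb y + emb z.
Proof. by rewrite /emb !raddfD. Qed.

Let embB y z : emb (y - z) = emb y - emb z.
Proof. by rewrite /emb !raddfB. Qed.

Let embZ (s : S) y : emb (s *: y) = iota s * emb y.
Proof. by rewrite /emb linearZ rmorphM. Qed.

Let iota_scalar (c : k) : iota c%:A = c%:A.
Proof. by rewrite linearZ rmorph1. Qed.

Let g_emb y : g (emb y) = 0.
Proof. by apply/kernel_g; exists (val y) => //; apply: valP. Qed.

Let emb_surj x : g x = 0 -> exists y, emb y = x.
Proof. by case/kernel_g=> y my <-; exists (Sub y my). Qed.

Let act_exists t y : exists z, emb z = phi t * emb y.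
Proof. by apply: emb_surj; rewrite rmorphM /= g_emb mulr0. Qed.

Let star t y : submodule mS := projT1 (cid (act_exists t y)).

Let starE t y : emb (star t y) = phi t * emb y.
Proof. exact: projT2 (cid (act_exists t y)). Qed.

Let psi_exists r : exists y, emb y = r - phi (g r).
Proof. by apply: emb_surj; rewrite rmorphB /= gphi subrr. Qed.

Let psi r : submodule mS := projT1 (cid (psi_exists r)).

Let psiE r : emb (psi r) = r - phi (g r).
Proof. exact: projT2 (cid (psi_exists r)). Qed.

(** [T] acts on the kernel of [g] by multiplication through [phi], and
    [(t, y) |-> phi t + y] has inverse [r |-> (g r, r - phi (g r))].  The
    subalgebra [S] is kept abstract, given by its inclusion [iota]. *)
Lemma retraction_semi_fiber :
  exists (star : bimodule_action T mS) (theta : {lrmorphism semi_fiber star -> R}),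
    [/\ bijective theta,
        kalgebra_hom (semi_fiber_ideal star mT) mR theta,
        forall t, theta (semi_fiber_inl star t) = phi t
      & forall y, theta (semi_fiber_inr star y) = iota (val y)].
Proof.
have starDl t t' y : star (t + t') y = star t y + star t' y.
  by apply: emb_inj; rewrite embD !starE rmorphD mulrDl.
have starDr t y y' : star t (y + y') = star t y + star t y'.
  by apply: emb_inj; rewrite embD !starE embD mulrDr.
have starM t t' y : star (t * t') y = star t (star t' y).
  by apply: emb_inj; rewrite !starE rmorphM mulrA.
have star_scalar (c : k) y : star c%:A y = (c%:A : S) *: y.
  by apply: emb_inj; rewrite starE embZ iota_scalar linearZ /= rmorph1.
have star_bimod t (s : S) y : star t (s *: y) = s *: star t y.
  by apply: emb_inj; rewrite !(starE, embZ) mulrCA.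
pose action := BimoduleAction starDl starDr starM star_scalar star_bimod.
pose theta (u : semi_fiber action) : R := phi u.1 + emb u.2.
have [||||th thE] := @lrmorphism_of k (semi_fiber action) R theta.
- by move=> u v; rewrite /theta raddfB embB /= opprD addrACA.
- by rewrite /theta rmorph1 /emb !raddf0 addr0.
- move=> u v; rewrite /theta; change ((u * v).1) with (u.1 * v.1).
  change ((u * v).2) with (star u.1 v.2 + star v.1 u.2 + (val u.2 : S) *: v.2).
  rewrite !embD embZ !starE rmorphM mulrDl !mulrDr -!addrA.
  by rewrite [phi v.1 * _]mulrC.
- move=> c u; rewrite /theta; change ((c *: u).1) with (c *: u.1).
  change ((c *: u).2) with ((c%:A : S) *: u.2).
  by rewrite embZ iota_scalar mulr_algl [phi (c *: _)]linearZ scalerDr.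
exists action, th; split.
- exists (fun r => (g r, psi r) : semi_fiber action) => [u|r]; rewrite thE /theta /=.
    have gu : g (phi u.1 + emb u.2) = u.1 by rewrite rmorphD /= gphi g_emb addr0.
    case: u gu => t y /= gu; congr (_, _) => //; apply: emb_inj.
    by rewrite psiE gu addrC addKr.
  by rewrite psiE addrC subrK.
- move=> u mu; rewrite thE; apply: idealD; first exact: phi_hom.
  have [rhoR rhoRA rhoR0] := kalgebra_residue kalgR.
  have [rhoT rhoTA rhoT0] := kalgebra_residue kalgT.
  case: retr => _ /(residue_hom g rhoTA rhoT0 rhoRA rhoR0) gE _ _ _.
  by apply/rhoR0; rewrite -gE g_emb raddf0.
- by move=> t; rewrite thE /theta /= /emb !raddf0 addr0.
- by move=> y; rewrite thE /theta /= raddf0 add0r.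
Qed.

End RetractionSemiFiber.

Theorem mainTheorem1 (k : fieldType) (R T : comAlgType k)
    (mR : ideal R) (mT : ideal T) (phi : {lrmorphism T -> R}) :
  is_kalgebra mR -> noetherian R -> local_ring mR ->
  is_kalgebra mT -> adic_complete mT ->
  kalgebra_hom mT mR phi -> flat_morphism phi ->
  let I := ideal_extension phi mT in
  (liftable_module (residue_module mR I) <-> has_retraction mT mR phi) /\
  (has_retraction mT mR phi <->
     exists a : ideal R, semi_fiber_decomposition mT mR phi a).
Proof.
move=> kalgR _ _ kalgT completeT hom flat_phi I; split; split.
- exact: retraction_of_liftable.
- by case=> g; apply: retraction_liftable.
- case=> g retr; exists (ring_kernel g : ideal R); split.
    by apply: kplus_kalgebra; apply/negP => /ring_kernelP/eqP; rewrite rmorph1 oner_eq0.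
  have [iota iotaE] := kplus_incl (ring_kernel g).
  have iota_inj : injective iota by move=> x y; rewrite !iotaE; apply: val_inj.
  have kernel_g x : g x = 0 <-> exists2 y, y \in kplus_ideal (ring_kernel g) & iota y = x.
    split=> [/ring_kernelP gx|[y my <-]]; last by rewrite iotaE; apply/ring_kernelP/my.
    have xS : x \in kplus_pred (ring_kernel g : ideal R).
      by apply/kplus_predP; exists 0; rewrite scale0r subr0.
    by exists (Sub x xS); rewrite ?iotaE.
  have [star [theta [bij_theta hom_theta thetaT thetaS]]] :=
    retraction_semi_fiber hom retr kalgR kalgT iota_inj kernel_g.
  exists star, theta; split=> // y.
  by rewrite -iotaE; apply: thetaS.
- case=> a [_ [star [theta [bij_theta hom_theta thetaT _]]]].
  exact: semi_fiber_retraction thetaT.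
Qed.
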